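(* Let $P$ be a naturally labelled forest with duplications on $\{1,2,\ldots,n\}$. Then $$\sum_{w \in \mathcal{L}(P)} q^{\mathrm{maj}(w)}= [n]!_q \cdot \frac{\prod_{\{J_1,J_2\} \in \Pi(P)} \left[\, |J_1|+|J_2| \,\right]_q }{\prod_{J \in \mathcal{J}_{\mathrm{conn}}(P)} \left[\, |J| \,\right]_q }.$$ In particular, upon setting $q=1$, $$|\mathcal{L}(P)| = n! \cdot \frac{\prod_{\{J_1,J_2\} \in \Pi(P)} (|J_1|+|J_2|)}{\prod_{J \in \mathcal{J}_{\mathrm{conn}}(P)} |J|}.$$
   Context: All posets are finite. A poset $P$ on $\{1,\ldots,n\}$ is naturally labelled if $i<_P j$ implies $i<j$ as integers. A linear extension of $P$ is a permutation $w=(w(1),\ldots,w(n))$ of $\{1,\ldots,n\}$ such that $w(i)<_P w(j)$ implies $i<j$; $\mathcal{L}(P)$ is the set of linear extensions. $\mathrm{maj}(w)=\sum_{i\in\{1,\ldots,n-1\}:\,w(i)>w(i+1)} i$. $[m]_q=1+q+\cdots+q^{m-1}$ and $[n]!_q=[1]_q[2]_q\cdots[n]_q$. An order ideal of $P$ is a subset $I$ with $p\le_P i\in I \Rightarrow p\in I$. A connected order ideal is a nonempty order ideal $J$ such that the Hasse diagram of $P$ restricted to $J$ is a connected graph; $\mathcal{J}_{\mathrm{conn}}(P)$ denotes the set of nonempty connected order ideals. Two connected order ideals intersect trivially if they are disjoint or one contains the other; otherwise they intersect nontrivially. $\Pi(P)$ is the set of unordered pairs $\{J_1,J_2\}$ of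 connected order ideals of $P$ intersecting nontrivially. Forests with duplications are the finite posets obtainable from one-element posets by iterating: (1) disjoint union $P_1\sqcup P_2$ (no relations between $P_1$ and $P_2$); (2) hanging $P_2$ below an element $a\in P_1$: on $P_1\sqcup P_2$ add relations $p_2<b$ for every $p_2\in P_2$ and every $b\in P_1$ with $b\ge_{P_1} a$ (then take the resulting order); (3) duplication of a hanger: an element $a$ of $P$ is a hanger if $P_{<a}$ is nonempty and $P$ is obtained by hanging $P_{<a}$ below $a$ in $P\setminus P_{<a}$ (equivalently, $P_{<a}\neq\varnothing$ and every path in the Hasse diagram of $P$ from an element of $P_{<a}$ to an element of $P\setminus P_{\le a}$ passes through $a$); the duplication of the hanger $a$ is the poset on $P\sqcup\{a'\}$ with the relations of $P$ together with $p<a'$ whenever $p<_P a$ and $a'<p$ whenever $a<_P p$. *)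

(* Defs.v *)
From HB Require Import structures.
From mathcomp Require Import all_boot all_order all_fingroup all_algebra.
Set Implicit Arguments. Unset Strict Implicit. Unset Printing Implicit Defensive.
Import GRing.Theory.
Local Open Scope ring_scope.

(* Posets are given by their non-strict order relation [le : rel T]. *)
Definition plt (T : finType) (le : rel T) (x y : T) : bool := le x y && (x != y).

Definition dunion_rel (T1 T2 : finType) (le1 : rel T1) (le2 : rel T2)
  : rel (T1 + T2)%type :=
  fun u v => match u, v with
  | inl x, inl y => le1 x y
  | inr x, inr y => le2 x y
  | _, _ => false
  end.

Definition hang_rel (T1 T2 : finType) (le1 : rel T1) (le2 : rel T2) (a : T1)
  : rel (T1 + T2)%type :=
  fun u v => match u, v with
  | inl x, inl y => le1 x y
  | inr x, inr y => le2 x y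
  | inr _, inl b => le1 a b
  | inl _, inr _ => false
  end.

(* a is a hanger: P_{<a} nonempty and P equals the poset obtained by hanging
   P_{<a} below a in P \ P_{<a}.  Unfolded: the only relations between
   p ∈ P_{<a} and b ∈ P \ P_{<a} are p < b exactly when a <= b. *)
Definition hanger (T : finType) (le : rel T) (a : T) : Prop :=
  (exists p, plt le p a) /\
  (forall p b, plt le p a -> ~~ plt le b a -> (le p b = le a b)).

(* duplication of a: new element a' = None *)
Definition dup_rel (T : finType) (le : rel T) (a : T) : rel (option T) :=
  fun u v => match u, v with
  | Some x, Some y => le x y
  | None, None => true
  | Some p, None => plt le p a
  | None, Some p => plt le a p
  end.

Inductive forest_dup : forall T : finType, rel T -> Prop :=
| fd_single : forest_dup (fun _ _ : unit => true)
| fd_union (T1 T2 : finType) (le1 : rel T1) (le2 : rel T2) :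
    forest_dup le1 -> forest_dup le2 -> forest_dup (dunion_rel le1 le2)
| fd_hang (T1 T2 : finType) (le1 : rel T1) (le2 : rel T2) (a : T1) :
    forest_dup le1 -> forest_dup le2 -> forest_dup (hang_rel le1 le2 a)
| fd_dup (T : finType) (le : rel T) (a : T) :
    forest_dup le -> hanger le a -> forest_dup (dup_rel le a)
| fd_iso (T U : finType) (le : rel T) (leU : rel U) (f : T -> U) :
    forest_dup le -> bijective f -> (forall x y, le x y = leU (f x) (f y)) ->
    forest_dup leU.

(* ---- Posets on {1..n}, encoded on 'I_n (label i+1 <-> i) ---- *)

Definition naturally_labelled (n : nat) (le : rel 'I_n) : Prop :=
  forall i j : 'I_n, plt le i j -> (i < j)%N.

(* w : 'S_n, w i is the (i+1)-th letter *)
Definition linext (n : nat) (le : rel 'I_n) : {set 'S_n} :=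
  [set w : 'S_n | [forall i, forall j, plt le (w i) (w j) ==> (i < j)%N]].

Definition maj (n : nat) (w : 'S_n) : nat :=
  let s := [seq val (w i) | i <- enum 'I_n] in
  (\sum_(0 <= i < n.-1 | (nth 0 s i.+1 < nth 0 s i)%N) i.+1)%N.

Definition order_ideal (T : finType) (le : rel T) (I : {set T}) : bool :=
  [forall p, forall i, ((i \in I) && le p i) ==> (p \in I)].

Definition covers (T : finType) (le : rel T) (x y : T) : bool :=
  plt le x y && [forall z, ~~ (plt le x z && plt le z y)].

Definition hasse_in (T : finType) (le : rel T) (J : {set T}) : rel T :=
  fun x y => [&& x \in J, y \in J & covers le x y || covers le y x].

Definition conn_ideal (T : finType) (le : rel T) (J : {set T}) : bool :=
  [&& J != set0, order_ideal le J &
      [forall x in J, forall y in J, connect (hasse_in le J) x y]].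

Definition Jconn (T : finType) (le : rel T) : {set {set T}} :=
  [set J | conn_ideal le J].

Definition intersect_nontriv (T : finType) (J1 J2 : {set T}) : bool :=
  [&& ~~ [disjoint J1 & J2], ~~ (J1 \subset J2) & ~~ (J2 \subset J1)].

Definition Pi (T : finType) (le : rel T) : {set {set {set T}}} :=
  [set S : {set {set T}} | (#|S| == 2)%N &&
     [forall J1 in S, forall J2 in S,
        (J1 != J2) ==> (conn_ideal le J1 && intersect_nontriv J1 J2)]].

Definition qint (m : nat) : {poly int} := \sum_(i < m) 'X^i.
Definition qfact (n : nat) : {poly int} := \prod_(i < n) qint i.+1.

(* Main.v *)
Require Import Defs.
From HB Require Import structures.
From mathcomp Require Import all_boot all_order all_fingroup all_algebra.
From mathcomp Require Import ring zify.
Import GRing.Theory.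
Local Open Scope ring_scope.
Set Implicit Arguments. Unset Strict Implicit. Unset Printing Implicit Defensive.

(** A P-partition is an order-reversing map [f : P -> nat].  Give every element
    [x] a positive weight [c x], and let [F_c] be the generating function of
    P-partitions by [\sum_x c x * f x].  By induction on the construction of a
    forest with duplications, [F_c] equals
    [\prod_{J1, J2} (1 - X^(c(J1) + c(J2))) / \prod_J (1 - X^c(J))]:
    - a disjoint union multiplies the two sides;
    - when [P2] hangs below [a], subtracting [f a] from [f] on [P2] splits [f]
      into a P2-partition and a P1-partition in which [a] has absorbed the weight
      of [P2];
    - when [a] is duplicated into [a, a'], split according to the larger of
      [f a, f a'] and lower [f] on the principal ideal of that element by the
      difference; this leaves a P-partition in which [a] carries the weight of
      both copies, and [1 / (1 - u) + v / (1 - v) = (1 - uv) / ((1 - u)(1 - v))]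
      produces the two new connected ideals and the new crossing pair.
    For weights 1 and a natural labelling, sorting the labels by decreasing [f]
    (ties by label) matches P-partitions with pairs of a linear extension [w] and
    a vector [k], of total weight [maj w + \sum_i i * k_i].  The powers of
    [1 - X] cancel because [|Jconn| = n + |Pi|].  All power series identities are
    read modulo [X^N], for every [N]. *)

(** * Integer polynomials modulo a power of X *)

Definition eqX (N : nat) (p q : {poly int}) : Prop := exists r, p = q + r * 'X^N.

Lemma eqX_refl N p : eqX N p p.
Proof. by exists 0; rewrite mul0r addr0. Qed.

Lemma eqX_sym N p q : eqX N p q -> eqX N q p.
Proof. by move=> [r ->]; exists (- r); ring. Qed.

Lemma eqX_trans N p q r : eqX N p q -> eqX N q r -> eqX N p r.
Proof. by move=> [u ->] [v ->]; exists (u + v); ring. Qed.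

Lemma eqX_add N p q p' q' : eqX N p q -> eqX N p' q' -> eqX N (p + p') (q + q').
Proof. by move=> [u ->] [v ->]; exists (u + v); ring. Qed.

Lemma eqX_mul N p q p' q' : eqX N p q -> eqX N p' q' -> eqX N (p * p') (q * q').
Proof.
move=> [u ->] [v ->]; exists (q * v + u * q' + u * v * 'X^N); ring.
Qed.

Lemma eqX_mull N p q r : eqX N p q -> eqX N (r * p) (r * q).
Proof. exact/eqX_mul/eqX_refl. Qed.

Lemma eqX_Xn N m : (N <= m)%N -> eqX N 'X^m 0.
Proof. by move=> le_Nm; exists 'X^(m - N); rewrite add0r -exprD subnK. Qed.

Lemma eqX_1subXn N m : (N <= m)%N -> eqX N (1 - 'X^m) 1.
Proof.
by move=> le_Nm; exists (- 'X^(m - N)); rewrite mulNr -exprD subnK.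
Qed.

Lemma eqX_eq p q : (forall N, eqX N p q) -> p = q.
Proof.
(* Coefficient [i] is already visible modulo ['X^(i + 1)]. *)
move=> pq; apply/polyP=> i; have [r ->] := pq i.+1.
by rewrite coefD coefMXn ltnS leqnn addr0.
Qed.

Lemma eqX_prod N (I : finType) (D : pred I) (F G : I -> {poly int}) :
  (forall i, D i -> eqX N (F i) (G i)) ->
  eqX N (\prod_(i | D i) F i) (\prod_(i | D i) G i).
Proof.
move=> FG; elim/big_ind2: _ => //; first exact: eqX_refl.
by move=> *; apply: eqX_mul.
Qed.

(* [p] is the generating function, modulo [X^N], of the elements of [A] by weight; the
   list [s] may contain further elements of [A], of weight at least [N]. *)
Definition is_gf (N : nat) (X : eqType) (A : pred X) (wt : X -> nat)
    (p : {poly int}) : Prop :=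
  exists s : seq X, [/\ uniq s, {in s, forall x, A x},
    (forall x, A x -> (wt x < N)%N -> x \in s)
    & eqX N p (\sum_(x <- s) 'X^(wt x))].

(** * Truncated generating functions *)

Section GeneratingFunctions.
Variable N : nat.

Lemma eqX_sum_filter (X : eqType) (wt : X -> nat) (s : seq X) :
  eqX N (\sum_(x <- s) 'X^(wt x))
        (\sum_(x <- [seq x <- s | (wt x < N)%N]) 'X^(wt x)).
Proof.
elim: s => [|x s IHs] /=; first by rewrite !big_nil; apply: eqX_refl.
rewrite big_cons; case: ltnP => wx; first by rewrite big_cons; apply: eqX_add; [apply: eqX_refl|].
by rewrite -[X in eqX N _ X]add0r; apply: eqX_add => //; apply: eqX_Xn.
Qed.

(** Two lists for the same family differ, up to order, only in elements of weight at least [N], and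
    these contribute multiples of ['X^N]. *)
Lemma is_gf_unique (X : eqType) (A : pred X) wt p q :
  is_gf N A wt p -> is_gf N A wt q -> eqX N p q.
Proof.
move=> [s [us sA As ps]] [t [ut tA At qt]].
apply: (eqX_trans ps); apply: (eqX_trans (eqX_sum_filter _ _)).
apply: eqX_sym; apply: (eqX_trans qt); apply: (eqX_trans (eqX_sum_filter _ _)).
rewrite (perm_big [seq x <- s | (wt x < N)%N]); first exact: eqX_refl.
apply: uniq_perm; rewrite ?filter_uniq // => x; rewrite !mem_filter.
case: (ltnP (wt x) N) => //= wx.
by apply/idP/idP=> [/tA|/sA] Ax; [apply: As | apply: At].
Qed.

Lemma is_gf_bij (X Y : eqType) (A : pred X) (B : pred Y) (wtX : X -> nat)
    (wtY : Y -> nat) (h : X -> Y) p :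
  (forall x, A x -> B (h x)) -> {in A, forall x, wtY (h x) = wtX x} ->
  {in A &, injective h} -> (forall y, B y -> exists2 x, A x & h x = y) ->
  is_gf N A wtX p -> is_gf N B wtY p.
Proof.
move=> AB wth inj_h surj_h [s [us sA As ps]].
exists (map h s); split.
- by rewrite map_inj_in_uniq // => x y /sA Ax /sA Ay; apply: inj_h.
- by move=> _ /mapP[x /sA Ax ->]; apply: AB.
- move=> _ /surj_h[x Ax <-]; rewrite wth // => wx.
  exact/map_f/As.
- apply: (eqX_trans ps); rewrite big_map [X in eqX N _ X]big_seq big_seq.
  rewrite (eq_bigr (fun x => 'X^(wtY (h x)))); first exact: eqX_refl.
  by move=> x /sA Ax; rewrite wth.
Qed.

Lemma is_gf_prod (X Y : eqType) (A : pred X) (B : pred Y) wtX wtY p q :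
  is_gf N A wtX p -> is_gf N B wtY q ->
  is_gf N (fun z : X * Y => A z.1 && B z.2)
    (fun z => (wtX z.1 + wtY z.2)%N) (p * q).
Proof.
move=> [s [us sA As ps]] [t [ut tB Bt qt]].
exists [seq (x, y) | x <- s, y <- t]; split.
- by apply: allpairs_uniq => // -[x y] [x' y'].
- by move=> _ /allpairsP[[x y] /= [/sA Ax /tB By ->]] /=; rewrite Ax By.
- move=> [x y] /= /andP[Ax By] wxy; apply/allpairsP; exists (x, y).
  by split=> //=; [apply: As | apply: Bt] => //; apply: leq_ltn_trans wxy;
     rewrite ?leq_addr ?leq_addl.
- apply: (eqX_trans (eqX_mul ps qt)); rewrite big_allpairs /=.
  rewrite mulr_suml; under [X in eqX N _ X]eq_bigr => x _.
    under eq_bigr => y _ do rewrite exprD.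
    rewrite -mulr_sumr; over.
  exact: eqX_refl.
Qed.

Lemma is_gf_disjointU (X : eqType) (A B C : pred X) wt p q :
  (forall x, C x = A x || B x) -> (forall x, A x -> ~~ B x) ->
  is_gf N A wt p -> is_gf N B wt q -> is_gf N C wt (p + q).
Proof.
move=> CAB AB [s [us sA As ps]] [t [ut tB Bt qt]].
exists (s ++ t); split.
- rewrite cat_uniq us ut andbT; apply/hasPn=> x /tB Bx; apply/negP=> /sA Ax.
  by move: (AB _ Ax); rewrite Bx.
- by move=> x; rewrite mem_cat CAB => /orP[/sA|/tB] ->; rewrite ?orbT.
- move=> x; rewrite CAB mem_cat => /orP[Ax|Bx] wx; first by rewrite As.
  by rewrite Bt ?orbT.
- by rewrite big_cat; apply: eqX_add.
Qed.

Lemma is_gf_shift (X : eqType) (A : pred X) wt d p :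
  is_gf N A wt p -> is_gf N A (fun x => (wt x + d)%N) (p * 'X^d).
Proof.
move=> [s [us sA As ps]]; exists s; split=> //.
- by move=> x Ax wx; apply: As => //; apply: leq_ltn_trans wx; rewrite leq_addr.
- under [X in eqX N _ X]eq_bigr => x _ do rewrite exprD.
  by rewrite -mulr_suml; apply: eqX_mul => //; apply: eqX_refl.
Qed.

Lemma is_gf_fin (T : finType) (A : {set T}) (wt : T -> nat) :
  is_gf N (mem A) wt (\sum_(x in A) 'X^(wt x)).
Proof.
exists (enum A); split=> [||x Ax _|]; rewrite ?enum_uniq ?mem_enum //.
- by move=> x; rewrite mem_enum.
- by rewrite big_enum; apply: eqX_refl.
Qed.

(** The sum plays the role of [1 / (1 - 'X^d)]: the product telescopes, and the remainder
    ['X^(d * N)] vanishes modulo ['X^N] because [d] is positive. *)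
Lemma geometric_sum d : (0 < d)%N ->
  eqX N ((\sum_(k < N) 'X^(d * k)) * (1 - 'X^d)) 1.
Proof.
move=> d_gt0; have -> : (\sum_(k < N) 'X^(d * k)) * (1 - 'X^d) = 1 - 'X^(d * N) :> {poly int}.
  under eq_bigr => k _ do rewrite exprM.
  by rewrite mulrC -[1 - 'X^d]opprB mulNr -subrX1 opprB exprM.
by apply: eqX_1subXn; rewrite leq_pmull.
Qed.

Lemma is_gf_nat d : (0 < d)%N ->
  is_gf N predT (fun k => (d * k)%N) (\sum_(k < N) 'X^(d * k)).
Proof.
move=> d_gt0; exists (index_iota 0 N); split=> [||k _ dk|]; rewrite ?iota_uniq //.
- by rewrite mem_index_iota (leq_ltn_trans _ dk) // leq_pmull.
- by rewrite big_mkord; apply: eqX_refl.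
Qed.

Definition fwt (T : finType) (c : T -> nat) (f : {ffun T -> nat}) : nat :=
  (\sum_x c x * f x)%N.

(** Since the weights are positive, one value of at least [N] pushes the total to at least [N].
    Functions into ['I_N] therefore suffice, and distributing the product over its sums enumerates
    them. *)
Lemma is_gf_ffun (T : finType) (c : T -> nat) : (forall x, (0 < c x)%N) ->
  is_gf N predT (fwt c) (\prod_x \sum_(k < N) 'X^(c x * k)).
Proof.
move=> c_gt0.
pose h (f : {ffun T -> 'I_N}) := [ffun x => val (f x)].
have h_inj : injective h.
  move=> f g /ffunP fg; apply/ffunP=> x; apply: val_inj.
  by have := fg x; rewrite !ffunE.
exists (map h (enum {: {ffun T -> 'I_N}})); split=> //.
- by rewrite map_inj_uniq ?enum_uniq.
- move=> f _ wf; have fN x : (f x < N)%N.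
    apply: leq_ltn_trans wf; rewrite /fwt (bigD1 x) //=.
    by apply: leq_trans (leq_addr _ _); rewrite leq_pmull.
  apply/mapP; exists [ffun x => Ordinal (fN x)]; first by rewrite mem_enum.
  by apply/ffunP=> x; rewrite !ffunE.
- rewrite big_map big_enum bigA_distr_bigA /=.
  under eq_bigr => f _ do rewrite -expr_sum.
  under [X in eqX N _ X]eq_bigr => f _.
    rewrite /fwt; under eq_bigr => x _ do rewrite ffunE.
    over.
  exact: eqX_refl.
Qed.

End GeneratingFunctions.

(** * Posets and connected order ideals *)

Definition poset (T : finType) (le : rel T) : Prop :=
  [/\ reflexive le, antisymmetric le & transitive le].

Lemma pltW (T : finType) (le : rel T) x y : plt le x y -> le x y.
Proof. by case/andP. Qed.

Lemma plt_le_trans (T : finType) (le : rel T) x y z :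
  poset le -> plt le x y -> le y z -> plt le x z.
Proof.
move=> [le_refl le_anti le_trans] /andP[xy nxy] yz.
rewrite /plt (le_trans y) //; apply: contraNneq nxy => xz.
by apply/eqP/le_anti; rewrite xy xz yz.
Qed.

Lemma le_plt_trans (T : finType) (le : rel T) x y z :
  poset le -> le x y -> plt le y z -> plt le x z.
Proof.
move=> [le_refl le_anti le_trans] xy /andP[yz nyz].
rewrite /plt (le_trans y) //; apply: contraNneq nyz => xz.
by apply/eqP/le_anti; rewrite -{2}xz xy yz.
Qed.

(** Induction on the size of the interval from [x] to [y]: unless [y] covers [x], some [z] lies
    strictly between them, and both subintervals are smaller. Being closed downwards, [J] contains
    the whole interval. *)
Lemma le_hasse_connect (T : finType) (le : rel T) (J : {set T}) x y :
  poset le -> (forall u v, v \in J -> le u v -> u \in J) ->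
  y \in J -> le x y -> connect (hasse_in le J) x y.
Proof.
move=> [le_refl le_anti le_trans] idealJ.
have [m] := ubnP #|[set z | le x z && le z y]|.
elim: m x y => // m IHm x y; rewrite ltnS => le_m yJ xy.
have [->|nxy] := eqVneq x y; first exact: connect0.
case cov: (covers le x y).
  by apply: connect1; rewrite /hasse_in yJ (idealJ _ _ yJ xy) cov.
move: cov; rewrite /covers {1}/plt xy nxy /= => /negbT/forallPn[z].
rewrite negbK => /andP[/andP[xz nxz] /andP[zy nzy]].
have zJ := idealJ _ _ yJ zy.
apply: (@connect_trans _ _ z); apply: IHm => //; apply: leq_trans le_m;
  apply/proper_card/properP; split.
- apply/subsetP=> u; rewrite !inE => /andP[-> uz]; exact: le_trans uz zy.
- exists y; rewrite !inE ?xy ?le_refl //=.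
  by apply: contra nzy => yz; apply/eqP/le_anti; rewrite zy yz.
- apply/subsetP=> u; rewrite !inE => /andP[zu ->].
  by rewrite (le_trans _ _ _ xz zu).
- exists x; rewrite !inE ?xy ?le_refl //= andbT.
  by apply: contra nxz => zx; apply/eqP/le_anti; rewrite zx xz.
Qed.

(* Connectedness as the absence of a nonconstant two-colouring that is constant on
   comparable pairs; on order ideals comparability can replace the covering relation. *)
Definition connected_in (T : finType) (le : rel T) (J : {set T}) : Prop :=
  forall g : pred T, {in J &, forall x y, le x y -> g x = g y} ->
    {in J &, forall x y, g x = g y}.

Lemma conn_idealP (T : finType) (le : rel T) (J : {set T}) : poset le ->
  conn_ideal le J <->
  [/\ exists x, x \in J, forall u v, v \in J -> le u v -> u \in J
    & connected_in le J].
Proof.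
move=> le_po; split.
  case/and3P=> /set0Pn J0 /forallP idealJ /forallP connJ.
  have ideal' u v : v \in J -> le u v -> u \in J.
    move=> vJ uv; have /forallP/(_ v) := idealJ u.
    by rewrite vJ uv.
  split=> // g gP x y xJ yJ.
  have /forallP/(_ y) := implyP (connJ x) xJ; rewrite yJ /= => xy.
  have: closed (hasse_in le J) g.
    move=> u v /and3P[uJ vJ] /orP[] /andP[/pltW uv _]; rewrite !unfold_in.
      exact: gP.
    by apply/esym/gP.
  by move=> /closed_connect/(_ _ _ xy).
case=> J0 idealJ connJ; apply/and3P; split; first exact/set0Pn.
  by apply/forallP=> u; apply/forallP=> v; apply/implyP=> /andP[]; apply: idealJ.
apply/forallP=> x; apply/implyP=> xJ; apply/forallP=> y; apply/implyP=> yJ.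
(* The colouring is reachability from [x] along Hasse edges inside [J]. *)
rewrite -(connJ (connect (hasse_in le J) x) _ x y xJ yJ) ?connect0 //.
move=> u v uJ vJ uv; apply: same_connect_r; last exact: le_hasse_connect.
apply: sym_connect_sym => s t; rewrite /hasse_in andbCA; congr [&& _, _ & _].
exact: orbC.
Qed.

Lemma in_Jconn (T : finType) (le : rel T) J : (J \in Jconn le) = conn_ideal le J.
Proof. by rewrite inE. Qed.

Lemma conn_ideal_principal (T : finType) (le : rel T) a :
  poset le -> conn_ideal le [set x | le x a].
Proof.
move=> le_po; have [le_refl _ le_trans] := le_po; apply/(conn_idealP _ le_po); split.
- by exists a; rewrite inE.
- by move=> u v; rewrite !inE => va uv; apply: le_trans uv va.
- move=> g gP x y xa ya; have aa : a \in [set x | le x a] by rewrite inE.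
  rewrite (gP x a) ?(gP y a) //; first by move: ya; rewrite inE.
  by move: xa; rewrite inE.
Qed.

(** The image of [i] is a down-set isomorphic to [T], so closure downwards and comparability inside
    it mean the same in both posets. *)
Lemma conn_ideal_imset (T U : finType) (le : rel T) (leU : rel U) (i : T -> U) (J : {set T}) :
  poset le -> poset leU -> injective i ->
  (forall x y, leU (i x) (i y) = le x y) ->
  (forall u x, leU u (i x) -> exists y, u = i y) ->
  conn_ideal leU (i @: J) = conn_ideal le J.
Proof.
move=> poT poU inj_i iE i_down; apply/idP/idP.
  move/(conn_idealP _ poU)=> [[_ /imsetP[x xJ _]] idealJ connJ].
  apply/(conn_idealP _ poT); split; first by exists x.
    move=> u v vJ uv; rewrite -(mem_imset _ _ inj_i).
    by apply: (idealJ _ (i v)); rewrite ?mem_imset ?iE.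
  move=> g gP y z yJ zJ.
  (* The colouring [g] transported along [i], false off the image. *)
  pose g' u := [exists x, (i x == u) && g x].
  have g'E t : g' (i t) = g t.
    apply/existsP/idP=> [[s /andP[/eqP/inj_i-> //]]|gt].
    by exists t; rewrite eqxx.
  rewrite -!g'E; apply: connJ; rewrite ?imset_f //.
  by move=> _ _ /imsetP[s sJ ->] /imsetP[t tJ ->]; rewrite iE !g'E; apply: gP.
move/(conn_idealP _ poT)=> [[x xJ] idealJ connJ].
apply/(conn_idealP _ poU); split; first by exists (i x); apply: imset_f.
  move=> u _ /imsetP[y yJ ->] uy; have [z uz] := i_down _ _ uy.
  rewrite uz mem_imset //; apply: (idealJ _ y) => //.
  by rewrite -iE -uz.
move=> g gP _ _ /imsetP[y yJ ->] /imsetP[z zJ ->].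
apply: (connJ (g \o i)) => //= s t sJ tJ st.
by apply: gP; rewrite ?imset_f ?iE.
Qed.

(** Here [h] collapses fibres and [s] picks a representative of each. An element of the preimage and
    its representative have a common lower bound, which is again in the preimage, so a colouring
    that respects comparability is constant on fibres and descends to [T]. *)
Lemma conn_ideal_preimset (T U : finType) (le : rel T) (leU : rel U)
    (h : U -> T) (s : T -> U) (J : {set T}) :
  poset le -> poset leU -> cancel s h ->
  (forall u v, leU u v -> le (h u) (h v)) ->
  (forall x y, leU (s x) (s y) = le x y) ->
  (forall u, exists v, leU v u && leU v (s (h u))) ->
  conn_ideal leU (h @^-1: J) = conn_ideal le J.
Proof.
move=> poT poU sK hM sE hs; apply/idP/idP.
  move/(conn_idealP _ poU)=> [[u uJ] idealJ connJ].
  apply/(conn_idealP _ poT); split; first by exists (h u); rewrite inE in uJ.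
    move=> x y yJ xy; have := idealJ (s x) (s y).
    by rewrite !inE !sK sE; apply.
  move=> g gP x y xJ yJ; have := connJ (g \o h) _ (s x) (s y); rewrite /= !sK.
  apply; rewrite ?inE ?sK //.
  by move=> v w; rewrite !inE => vJ wJ /hM; apply: gP.
move/(conn_idealP _ poT)=> [[x xJ] idealJ connJ].
have ideal' u v : v \in h @^-1: J -> leU u v -> u \in h @^-1: J.
  by rewrite !inE => vJ /hM; apply: idealJ.
apply/(conn_idealP _ poU); split => //; first by exists (s x); rewrite inE sK.
move=> g gP.
have gs u : u \in h @^-1: J -> g u = g (s (h u)).
  move=> uJ; have [v /andP[vu vs]] := hs u.
  have vJ := ideal' _ _ uJ vu.
  rewrite -(gP v u) // -(gP v (s (h u))) //; move: uJ; by rewrite !inE sK.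
move=> u v uJ vJ; rewrite gs // [RHS]gs //.
rewrite !inE in uJ vJ; apply: (connJ (g \o s)) => //= y z yJ zJ yz.
by apply: gP; rewrite ?inE ?sK ?sE.
Qed.

(** * Crossing pairs in a family of sets *)

Definition crossing (T : finType) (A : {set {set T}}) : {set {set {set T}}} :=
  [set S : {set {set T}} | (#|S| == 2)%N &&
     [forall J1 in S, forall J2 in S,
        (J1 != J2) ==> ((J1 \in A) && intersect_nontriv J1 J2)]].

(** Passing to an arbitrary family allows the crossing pairs to be computed piece by piece when the
    connected ideals split as a union. *)
Lemma PiE (T : finType) (le : rel T) : Pi le = crossing (Jconn le).
Proof.
apply/setP=> S; rewrite !inE; congr (_ && _).
apply: eq_forallb => J; congr (_ ==> _); apply: eq_forallb => K.
by rewrite in_Jconn.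
Qed.

Lemma intersect_nontrivC (T : finType) (J K : {set T}) :
  intersect_nontriv J K = intersect_nontriv K J.
Proof.
by rewrite /intersect_nontriv disjoint_sym; congr (_ && _); apply: andbC.
Qed.

Lemma intersect_nontriv_neq (T : finType) (J K : {set T}) :
  intersect_nontriv J K -> J != K.
Proof. by case/and3P=> _ /negP JK _; apply/eqP=> eqJK; apply: JK; rewrite eqJK. Qed.

Lemma crossingP (T : finType) (A S : {set _}) :
  reflect (exists J K : {set T},
             [/\ J \in A, K \in A, intersect_nontriv J K & S = [set J; K]])
          (S \in crossing A).
Proof.
apply: (iffP idP); rewrite inE.
  case/andP=> /cards2P[J [K [JK ->]]] /forallP SP.
  have H (L M : {set T}) : L \in [set J; K] -> M \in [set J; K] -> L != M ->
      (L \in A) && intersect_nontriv L M.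
    by move=> LS MS LM; have /implyP/(_ LS)/forallP/(_ M) := SP L; rewrite MS LM.
  exists J, K; have /andP[-> ->] : (J \in A) && intersect_nontriv J K.
    by apply: H; rewrite ?set21 ?set22.
  by have /andP[-> _] : (K \in A) && intersect_nontriv K J
    by apply: H; rewrite ?set21 ?set22 // eq_sym.
move=> [J [K [JA KA JK ->]]]; rewrite cards2 (intersect_nontriv_neq JK) /=.
apply/forallP=> L; apply/implyP=> LS; apply/forallP=> M; apply/implyP=> MS.
apply/implyP; move: LS MS; rewrite !inE.
move=> /orP[] /eqP-> /orP[] /eqP->; rewrite ?eqxx // ?JA ?KA //.
by rewrite intersect_nontrivC.
Qed.

Lemma crossingU (T : finType) (A B : {set {set T}}) :
  {in A & B, forall J K, ~~ intersect_nontriv J K} ->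
  crossing (A :|: B) = crossing A :|: crossing B.
Proof.
move=> AB; apply/setP=> S; rewrite in_setU; apply/crossingP/orP.
  move=> [J [K [/setUP[]JA /setUP[]KA JK ->]]].
  - by left; apply/crossingP; exists J, K.
  - by move: (AB _ _ JA KA); rewrite JK.
  - by move: (AB _ _ KA JA); rewrite intersect_nontrivC JK.
  - by right; apply/crossingP; exists J, K.
by move=> [] /crossingP[J [K [JA KA JK ->]]]; exists J, K;
  rewrite !inE JA KA ?orbT.
Qed.

Lemma crossing_disjoint (T : finType) (A B : {set {set T}}) :
  [disjoint A & B] -> [disjoint crossing A & crossing B].
Proof.
move=> AB; apply/pred0P=> S /=; apply/negP=> /andP[].
case/crossingP=> J [K [JA KA JK ->]] /crossingP[J' [K' [JB KB _ E]]].
have := set21 J K; rewrite E !inE => /orP[] /eqP JE.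
  by have := disjointFr AB JA; rewrite JE JB.
by have := disjointFr AB JA; rewrite JE KB.
Qed.

Lemma crossing_imset (T U : finType) (h : {set T} -> {set U}) (A : {set {set T}}) :
  (forall J K, intersect_nontriv (h J) (h K) = intersect_nontriv J K) ->
  crossing (h @: A) = [set h @: S | S : {set {set T}} in crossing A].
Proof.
move=> hE; apply/setP=> S; apply/crossingP/imsetP.
  move=> [_ [_ [/imsetP[J JA ->] /imsetP[K KA ->]]]]; rewrite hE => JK ->.
  exists [set J; K]; last by rewrite imsetU1 imset_set1.
  by apply/crossingP; exists J, K.
move=> [_ /crossingP[J [K [JA KA JK ->]]] ->]; exists (h J), (h K).
by rewrite !imset_f // hE imsetU1 imset_set1.
Qed.

Lemma intersect_nontriv_imset (T U : finType) (i : T -> U) (J K : {set T}) :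
  injective i ->
  intersect_nontriv (i @: J) (i @: K) = intersect_nontriv J K.
Proof.
move=> inj_i; rewrite /intersect_nontriv -!setI_eq0 -imsetI; last by move=> x y _ _; apply: inj_i.
rewrite imset_eq0; congr [&& _, ~~ _ & ~~ _].
  by apply/subsetP/subsetP => JK x; [move/(imset_f i)/JK | move=> /imsetP[y /JK yK ->]]; rewrite mem_imset.
by apply/subsetP/subsetP => JK x; [move/(imset_f i)/JK | move=> /imsetP[y /JK yK ->]]; rewrite mem_imset.
Qed.

Lemma preimset_can_inj (T U : finType) (h : U -> T) (s : T -> U) :
  cancel s h -> injective (fun J : {set T} => h @^-1: J).
Proof.
move=> sK J K /setP JK; apply/setP=> x.
by have := JK (s x); rewrite !inE sK.
Qed.

Lemma intersect_nontriv_preimset (T U : finType) (h : U -> T) (s : T -> U)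
    (J K : {set T}) : cancel s h ->
  intersect_nontriv (h @^-1: J) (h @^-1: K) = intersect_nontriv J K.
Proof.
move=> sK; have sub (L M : {set T}) : (h @^-1: L \subset h @^-1: M) = (L \subset M).
  apply/subsetP/subsetP => LM x; last by rewrite !inE; apply: LM.
  by move=> xL; have := LM (s x); rewrite !inE sK; apply.
rewrite /intersect_nontriv !sub -!setI_eq0 -preimsetI; congr (~~ _ && _).
apply/eqP/eqP => [E|->]; last by rewrite preimset0.
by apply: (preimset_can_inj sK); rewrite E preimset0.
Qed.

(** * Weights and the two products over ideals *)

Definition cwt (T : finType) (c : T -> nat) (J : {set T}) : nat :=
  (\sum_(x in J) c x)%N.

Definition ideal_den (T : finType) (c : T -> nat) (A : {set {set T}}) : {poly int} :=
  \prod_(J in A) (1 - 'X^(cwt c J)).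

Definition ideal_num (T : finType) (c : T -> nat) (A : {set {set T}}) : {poly int} :=
  \prod_(S in crossing A) (1 - 'X^(\sum_(J in S) cwt c J)).

Lemma ideal_denU (T : finType) (c : T -> nat) (A B : {set {set T}}) :
  [disjoint A & B] -> ideal_den c (A :|: B) = ideal_den c A * ideal_den c B.
Proof.
by move=> AB; rewrite /ideal_den -bigU //; apply: eq_bigl => J; rewrite !inE.
Qed.

Lemma ideal_numU (T : finType) (c : T -> nat) (A B : {set {set T}}) :
  [disjoint A & B] -> {in A & B, forall J K, ~~ intersect_nontriv J K} ->
  ideal_num c (A :|: B) = ideal_num c A * ideal_num c B.
Proof.
move=> AB ncAB; rewrite /ideal_num crossingU // -bigU ?crossing_disjoint //.
by apply: eq_bigl => S; rewrite !inE.
Qed.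

Lemma card_crossingU (T : finType) (A B : {set {set T}}) :
  [disjoint A & B] -> {in A & B, forall J K, ~~ intersect_nontriv J K} ->
  #|crossing (A :|: B)| = (#|crossing A| + #|crossing B|)%N.
Proof.
by move=> AB ncAB; rewrite crossingU // cardsU disjoint_setI0 ?crossing_disjoint // cards0 subn0.
Qed.

Lemma card_disjointU (T : finType) (A B : {set T}) :
  [disjoint A & B] -> #|A :|: B| = (#|A| + #|B|)%N.
Proof. by move=> AB; rewrite cardsU disjoint_setI0 // cards0 subn0. Qed.

Section ImageFamily.
Variables (T U : finType) (h : {set T} -> {set U}).
Hypothesis h_inj : injective h.

Lemma ideal_den_imset (c : T -> nat) (c' : U -> nat) (A : {set {set T}}) :
  (forall J, cwt c' (h J) = cwt c J) ->
  ideal_den c' (h @: A) = ideal_den c A.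
Proof.
move=> hc; rewrite /ideal_den big_imset; last by move=> ? ? _ _; apply: h_inj.
by apply: eq_bigr => J _; rewrite hc.
Qed.

Hypothesis hE : forall J K, intersect_nontriv (h J) (h K) = intersect_nontriv J K.

Lemma ideal_num_imset (c : T -> nat) (c' : U -> nat) (A : {set {set T}}) :
  (forall J, cwt c' (h J) = cwt c J) ->
  ideal_num c' (h @: A) = ideal_num c A.
Proof.
move=> hc; rewrite /ideal_num crossing_imset // big_imset; last first.
  by move=> ? ? _ _; apply: imset_inj.
apply: eq_bigr => S _; rewrite big_imset; last by move=> ? ? _ _; apply: h_inj.
by under eq_bigr => J _ do rewrite hc.
Qed.

Lemma card_crossing_imset (A : {set {set T}}) :
  #|crossing (h @: A)| = #|crossing A|.
Proof. by rewrite crossing_imset // card_imset //; apply: imset_inj. Qed.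

End ImageFamily.

Lemma crossing2 (T : finType) (J K : {set T}) : intersect_nontriv J K ->
  crossing [set J; K] = [set [set J; K]].
Proof.
move=> JK; apply/setP=> S; rewrite in_set1; apply/crossingP/eqP; last first.
  by move=> ->; exists J, K; rewrite !inE !eqxx orbT.
move=> [L [M [+ + LM ->]]]; have := intersect_nontriv_neq LM.
rewrite !inE => nLM /orP[] /eqP L_ /orP[] /eqP M_; subst L M => //;
  rewrite ?eqxx // in nLM.
exact: setUC.
Qed.

(** Along [hang_proj] this gives [a] its own weight plus that of all of [T2]; along [dup_proj] it
    gives [a] the weight of both copies. *)
Definition pushforward (T U : finType) (h : U -> T) (c : U -> nat) (x : T) : nat :=
  (\sum_(u | h u == x) c u)%N.

Lemma cwt_preimset (T U : finType) (h : U -> T) (c : U -> nat) (J : {set T}) :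
  cwt c (h @^-1: J) = cwt (pushforward h c) J.
Proof.
rewrite /cwt /pushforward (partition_big h (mem J)) /=; last by move=> u; rewrite inE.
apply: eq_bigr => x xJ; apply: eq_bigl => u; rewrite inE.
by case: eqP => [->|]; rewrite ?xJ ?andbF.
Qed.

Lemma cwt_imset (T U : finType) (i : T -> U) (c : U -> nat) (J : {set T}) :
  injective i -> cwt c (i @: J) = cwt (c \o i) J.
Proof. by move=> inj_i; rewrite /cwt big_imset //= => ? ? _ _; apply: inj_i. Qed.

Lemma pushforward_gt0 (T U : finType) (h : U -> T) (s : T -> U) (c : U -> nat) x :
  cancel s h -> (forall u, (0 < c u)%N) -> (0 < pushforward h c x)%N.
Proof.
move=> sK c_gt0; rewrite /pushforward (bigD1 (s x)) /= ?sK //.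
by rewrite addn_gt0 c_gt0.
Qed.

Lemma fwt_pushforward (T U : finType) (h : U -> T) (c : U -> nat) f :
  fwt (pushforward h c) f = (\sum_u c u * f (h u))%N.
Proof.
rewrite /fwt [RHS](partition_big h predT) //=; apply: eq_bigr => x _.
by rewrite big_distrl; apply: eq_bigr => u /eqP->.
Qed.

(** * Connected ideals under union, hanging and duplication *)

Section DisjointUnion.
Variables (T1 T2 : finType) (le1 : rel T1) (le2 : rel T2).
Hypotheses (po1 : poset le1) (po2 : poset le2).

Lemma dunion_poset : poset (dunion_rel le1 le2).
Proof.
have [r1 a1 t1] := po1; have [r2 a2 t2] := po2; split.
- by case=> x /=.
- by move=> [x|x] [y|y] //= => [/a1|/a2] ->.
- by move=> [y|y] [x|x] [z|z] //=; [apply: t1 | apply: t2].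
Qed.

Lemma Jconn_dunion : Jconn (dunion_rel le1 le2) =
  [set inl @: J | J : {set T1} in Jconn le1] :|: [set inr @: J | J : {set T2} in Jconn le2].
Proof.
have po := dunion_poset.
have inlE (J : {set T1}) : conn_ideal (dunion_rel le1 le2) (inl @: J) = conn_ideal le1 J.
  by apply: conn_ideal_imset => // [x y [//]|[x|x] y //= _]; exists x.
have inrE (J : {set T2}) : conn_ideal (dunion_rel le1 le2) (inr @: J) = conn_ideal le2 J.
  by apply: conn_ideal_imset => // [x y [//]|[x|x] y //= _]; exists x.
apply/setP=> K; rewrite !inE; apply/idP/orP; last first.
  by move=> [] /imsetP[J + ->]; rewrite in_Jconn ?inlE ?inrE.
move=> K_conn; have /(conn_idealP _ po)[[u uK] _ connK] := K_conn.
(* Comparable elements lie in the same summand, so [is_inl] is an admissible colouring. *)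
have sideK v : v \in K -> is_inl v = is_inl u.
  by move=> vK; apply: connK => // -[x|x] [y|y].
case: u uK sideK => x xK sideK; [left | right].
  have KE : K = inl @: (inl @^-1: K : {set T1}).
    apply/setP=> v; apply/idP/imsetP=> [vK|[y + ->]]; last by rewrite inE.
    by case: v vK (sideK _ vK) => // y yK _; exists y; rewrite ?inE.
  by rewrite KE imset_f // in_Jconn -inlE -KE.
have KE : K = inr @: (inr @^-1: K : {set T2}).
  apply/setP=> v; apply/idP/imsetP=> [vK|[y + ->]]; last by rewrite inE.
  by case: v vK (sideK _ vK) => // y yK _; exists y; rewrite ?inE.
by rewrite KE imset_f // in_Jconn -inrE -KE.
Qed.

Lemma imset_inl_inr_disjoint (J : {set T1}) (K : {set T2}) :
  [disjoint (inl @: J : {set T1 + T2}) & inr @: K].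
Proof.
by apply/pred0P=> u /=; apply/negP=> /andP[/imsetP[x _ ->] /imsetP[]].
Qed.

Lemma Jconn_dunion_disjoint :
  [disjoint [set (inl @: J : {set T1 + T2}) | J : {set T1} in Jconn le1]
   & [set inr @: J | J : {set T2} in Jconn le2]].
Proof.
apply/pred0P=> K /=; apply/negP=> /andP[/imsetP[J + ->] /imsetP[L _ JL]].
rewrite in_Jconn => /(conn_idealP _ po1)[[x xJ] _ _].
have : inl x \in (inl @: J : {set T1 + T2}) by rewrite imset_f.
by rewrite JL => /imsetP[].
Qed.

Lemma Jconn_dunion_noncrossing :
  {in [set (inl @: J : {set T1 + T2}) | J : {set T1} in Jconn le1]
   & [set inr @: J | J : {set T2} in Jconn le2],
   forall J K, ~~ intersect_nontriv J K}.
Proof.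
move=> _ _ /imsetP[J _ ->] /imsetP[K _ ->].
by rewrite /intersect_nontriv imset_inl_inr_disjoint.
Qed.

End DisjointUnion.

Section Hanging.
Variables (T1 T2 : finType) (le1 : rel T1) (le2 : rel T2) (a : T1).
Hypotheses (po1 : poset le1) (po2 : poset le2).

(** Preimages under this map contain all of [T2] or none of it, according to whether they contain
    [a]. *)
Definition hang_proj (u : T1 + T2) : T1 := if u is inl x then x else a.

Lemma inl_hangK : cancel inl hang_proj. Proof. by []. Qed.

Lemma hang_poset : poset (hang_rel le1 le2 a).
Proof.
have [r1 a1 t1] := po1; have [r2 a2 t2] := po2; split.
- by case=> x /=.
- by move=> [x|x] [y|y] //=; rewrite ?andbF //; [move/a1-> | move/a2->].
- by move=> [y|y] [x|x] [z|z] //=; [apply: t1 | move=> ay /(t1 _ _ _ ay) | apply: t2].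
Qed.

(** An ideal containing [a] contains everything hung below it and is a preimage under [hang_proj].
    In an ideal avoiding [a], no element of [T2] is comparable to one of [T1], since the latter
    would be above [a]; connectedness then keeps the ideal on one side. *)
Lemma Jconn_hang : Jconn (hang_rel le1 le2 a) =
  [set hang_proj @^-1: J | J : {set T1} in Jconn le1] :|: [set inr @: J | J : {set T2} in Jconn le2].
Proof.
have po := hang_poset; have [r1 _ _] := po1; have [r2 _ _] := po2.
have preE (J : {set T1}) : conn_ideal (hang_rel le1 le2 a) (hang_proj @^-1: J) = conn_ideal le1 J.
  apply: (@conn_ideal_preimset _ _ _ _ _ inl) => //.
    by move=> [x|x] [y|y] //=.
  by move=> [x|x] /=; [exists (inl x) | exists (inr x)]; rewrite /= ?r1 ?r2.
have inrE (J : {set T2}) : conn_ideal (hang_rel le1 le2 a) (inr @: J) = conn_ideal le2 J.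
  by apply: conn_ideal_imset => // [x y [//]|[x|x] y //= _]; exists x.
apply/setP=> K; rewrite !inE; apply/idP/orP; last first.
  by move=> [] /imsetP[J + ->]; rewrite in_Jconn ?preE ?inrE.
move=> K_conn; have /(conn_idealP _ po)[[u uK] idealK connK] := K_conn.
have preK : K = hang_proj @^-1: (inl @^-1: K) ->
    K \in [set hang_proj @^-1: J | J : {set T1} in Jconn le1].
  by move=> KE; rewrite KE; apply/imset_f; rewrite in_Jconn -preE -KE.
have [aK|naK] := boolP (inl a \in K).
  left; apply/preK/setP=> -[x|x]; rewrite !inE //= aK.
  by apply: (idealK _ (inl a)) => /=.
have sideK v : v \in K -> is_inl v = is_inl u.
  move=> vK; apply: connK => // -[x|x] [y|y] //= _ yK ay.
  by move: naK; rewrite (idealK _ (inl y)).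
case: u uK sideK => x xK sideK; [left | right].
  apply/preK/setP=> -[y|y]; rewrite !inE //= (negPf naK).
  by apply/negP=> /sideK.
have KE : K = inr @: (inr @^-1: K : {set T2}).
  apply/setP=> v; apply/idP/imsetP=> [vK|[y + ->]]; last by rewrite inE.
  by case: v vK (sideK _ vK) => // y yK _; exists y; rewrite ?inE.
by rewrite KE imset_f // in_Jconn -inrE -KE.
Qed.

Lemma Jconn_hang_disjoint :
  [disjoint [set hang_proj @^-1: J | J : {set T1} in Jconn le1]
   & [set inr @: J | J : {set T2} in Jconn le2]].
Proof.
apply/pred0P=> K /=; apply/negP=> /andP[/imsetP[J + ->] /imsetP[L _ JL]].
rewrite in_Jconn => /(conn_idealP _ po1)[[x xJ] _ _].
have : inl x \in hang_proj @^-1: J by rewrite inE.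
by rewrite JL => /imsetP[].
Qed.

Lemma Jconn_hang_noncrossing :
  {in [set hang_proj @^-1: J | J : {set T1} in Jconn le1]
   & [set inr @: J | J : {set T2} in Jconn le2],
   forall J K, ~~ intersect_nontriv J K}.
Proof.
move=> _ _ /imsetP[J _ ->] /imsetP[K _ ->]; rewrite /intersect_nontriv.
have [aJ|naJ] := boolP (a \in J).
  suff -> : inr @: K \subset hang_proj @^-1: J by rewrite !andbF.
  by apply/subsetP=> _ /imsetP[y _ ->]; rewrite inE.
suff -> : [disjoint hang_proj @^-1: J & inr @: K] by [].
apply/pred0P=> u /=; apply/negP=> /andP[+ /imsetP[y _ uy]].
by rewrite uy inE (negPf naJ).
Qed.

End Hanging.

Section Duplication.
Variables (T : finType) (le : rel T) (a : T).
Hypotheses (po : poset le) (hang_a : hanger le a).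

Definition dup_proj (u : option T) : T := odflt a u.

Lemma Some_dupK : cancel Some dup_proj. Proof. by []. Qed.

Lemma dup_poset : poset (dup_rel le a).
Proof.
have [r an t] := po; split.
- by case=> [x|] /=.
- move=> [x|] [y|] //= => [/an -> //||] /andP[xa ax].
    by have := plt_le_trans po xa (pltW ax); rewrite /plt eqxx andbF.
  by have := plt_le_trans po xa (pltW ax); rewrite /plt eqxx andbF.
- move=> [y|] [x|] [z|] //=.
  + exact: t.
  + exact: le_plt_trans.
  + exact: plt_le_trans.
  + by move=> xa /pltW/(plt_le_trans po xa)/pltW.
Qed.

Let Qa := [set v | dup_rel le a v (Some a)].
Let Qa' := [set v | dup_rel le a v None].

(** Being strictly below [a] is a colouring that respects comparability in [J]: if [u] is strictly
    below [a] and [v] above [u] is not, the hanger condition puts [v] above [a], forcing [a] into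
    [J]. *)
Lemma hanger_dichotomy (J : {set T}) : conn_ideal le J -> a \notin J ->
  {in J, forall x, plt le x a} \/ {in J, forall x, ~~ plt le x a}.
Proof.
move=> /(conn_idealP _ po)[[x xJ] idealJ connJ] naJ.
have side y : y \in J -> plt le y a = plt le x a.
  move=> yJ; apply: (connJ (fun y => plt le y a)) => // u v uJ vJ uv.
  apply/idP/idP=> [ua|]; last exact: le_plt_trans.
  apply: contraNT naJ => nva; apply: (idealJ _ v) => //.
  by rewrite -(hang_a.2 u v).
by case xa : (plt le x a) side => side; [left | right] => y /side ->.
Qed.

(** An ideal with both or neither of the copies of [a] is a preimage under [dup_proj]. One with a
    single copy is the principal ideal of that copy: leaving this principal ideal upwards leads
    above both copies, so the other copy would belong to the ideal too. *)
Lemma Jconn_dup : Jconn (dup_rel le a) =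
  [set dup_proj @^-1: J | J : {set T} in Jconn le] :|: [set Qa; Qa'].
Proof.
have po' := dup_poset; have [r an t] := po.
have [q qa] := hang_a.1.
have preE (J : {set T}) : conn_ideal (dup_rel le a) (dup_proj @^-1: J) = conn_ideal le J.
  apply: (@conn_ideal_preimset _ _ _ _ _ Some) => //.
    by move=> [x|] [y|] //= /pltW.
  move=> [x|]; first by exists (Some x); rewrite /= r.
  (* An element strictly below [a] is a common lower bound of the two copies. *)
  by exists (Some q); rewrite /= qa (pltW qa).
apply/setP=> K; rewrite !inE; apply/idP/idP; last first.
  case/orP=> [/imsetP[J + ->]|]; first by rewrite in_Jconn preE.
  by case/orP=> /eqP->; apply: conn_ideal_principal.
move=> K_conn; have /(conn_idealP _ po')[_ idealK connK] := K_conn.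
have [aK|naK] := boolP (Some a \in K); have [a'K|na'K] := boolP (None \in K).
- have KE : K = dup_proj @^-1: (Some @^-1: K).
    by apply/setP=> -[x|]; rewrite !inE //= aK.
  by rewrite [X in X \in _]KE imset_f // in_Jconn -preE -KE.
- suff -> : K = Qa by rewrite eqxx orbT.
  apply/setP=> v; rewrite inE; apply/idP/idP=> [vK|]; last exact: idealK.
  (* The colouring is membership in [Qa]. A comparable pair [p], [b] leaving [Qa] has [b] strictly
     above [a], by the hanger condition or because [p] is [a] itself; then [None] is below [b], a
     contradiction. *)
  have := connK (fun v => dup_rel le a v (Some a)) _ v (Some a) vK aK.
  rewrite /= r => -> // u w uK wK uw; apply/idP/idP=> [ua|]; last first.
    by have [_ _ t'] := po'; apply: t' uw.
  case: u w uK wK uw ua => [p|] [b|] //= pK bK; rewrite ?(negPf na'K) // in pK bK *.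
  move=> pb pa; apply: contraNT na'K => nba; apply: (idealK _ (Some b)) => //=.
  have [pa'|] := eqVneq p a.
    by rewrite /plt -pa' pb pa'; apply: contraNneq nba => <-.
  move=> npa; rewrite /plt -(hang_a.2 p b) ?pb ?/plt ?pa //=.
    by apply: contraNneq nba => <-.
  by rewrite (negPf nba).
- suff -> : K = Qa' by rewrite eqxx !orbT.
  apply/setP=> v; rewrite inE; apply/idP/idP=> [vK|]; last exact: idealK.
  have := connK (fun v => dup_rel le a v None) _ v None vK a'K.
  move=> /= -> // u w uK wK uw; apply/idP/idP=> [ua|]; last first.
    by have [_ _ t'] := po'; apply: t' uw.
  case: w wK uw => [b|] //= bK uw; apply: contraNT naK => nba.
  apply: (idealK _ (Some b)) => //=.
  case: u uK uw ua => [p|] //= pK pb pa; last exact: pltW.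
  by rewrite -(hang_a.2 p b).
- have KE : K = dup_proj @^-1: (Some @^-1: K).
    by apply/setP=> -[x|]; rewrite !inE //= (negPf naK) (negPf na'K).
  by rewrite [X in X \in _]KE imset_f // in_Jconn -preE -KE.
Qed.

(** [Qa] and [Qa'] each contain exactly one copy of [a], whereas a preimage under [dup_proj]
    contains both or neither. *)
Lemma Jconn_dup_disjoint :
  [disjoint [set dup_proj @^-1: J | J : {set T} in Jconn le] & [set Qa; Qa']].
Proof.
have [r _ _] := po.
apply/pred0P=> K /=; apply/negP=> /andP[/imsetP[J _ ->]].
rewrite !inE => /orP[] /eqP/setP E; have := E None; have := E (Some a);
  by rewrite !inE /= ?r /plt eqxx andbF => ->.
Qed.

(** If [a] is in [J], the preimage of [J] contains both principal ideals. Otherwise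
    [hanger_dichotomy] places [J] inside the common part of these two ideals or disjoint from it. *)
Lemma Jconn_dup_noncrossing :
  {in [set dup_proj @^-1: J | J : {set T} in Jconn le] & [set Qa; Qa'],
   forall J K, ~~ intersect_nontriv J K}.
Proof.
have [r _ _] := po.
move=> _ K /imsetP[J + ->] KQ; rewrite in_Jconn => J_conn.
have [_ idealJ _] := (conn_idealP _ po).1 J_conn.
rewrite /intersect_nontriv.
have QK p : plt le p a -> Some p \in K.
  by move: KQ; rewrite !inE => /orP[] /eqP-> pa; rewrite inE //= pltW.
have KQ' p : Some p \in K -> p != a -> plt le p a.
  by move: KQ; rewrite !inE => /orP[] /eqP->; rewrite inE //= /plt => -> ->.
have [aJ|naJ] := boolP (a \in J).
  suff -> : K \subset dup_proj @^-1: J by rewrite !andbF.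
  apply/subsetP=> -[p|] pK; rewrite inE //=.
  have [-> //|/(KQ' p pK)/pltW] := eqVneq p a; exact: idealJ.
have [JQ|nJQ] := hanger_dichotomy J_conn naJ.
  suff -> : dup_proj @^-1: J \subset K by rewrite !andbF.
  apply/subsetP=> -[p|]; rewrite inE /=; first by move=> /JQ/QK.
  by rewrite (negPf naJ).
suff -> : [disjoint dup_proj @^-1: J & K] by [].
apply/pred0P=> -[p|] /=; rewrite !inE /= ?(negPf naJ) //.
apply/negP=> /andP[pJ pK]; move: (nJQ _ pJ); rewrite KQ' //.
by apply: contraNneq naJ => <-.
Qed.

Lemma intersect_nontriv_dup : intersect_nontriv Qa Qa'.
Proof.
have [r _ _] := po; have [q qa] := hang_a.1; apply/and3P; split.
- apply/pred0Pn; exists (Some q); by rewrite /= !inE /= qa (pltW qa).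
- by apply/subsetPn; exists (Some a); rewrite inE /= ?r // /plt eqxx andbF.
- by apply/subsetPn; exists None; rewrite inE //= /plt eqxx andbF.
Qed.

End Duplication.

(** * Isomorphic copies and the number of connected ideals *)

Lemma poset_iso (T U : finType) (le : rel T) (leU : rel U) (f : T -> U) :
  bijective f -> (forall x y, le x y = leU (f x) (f y)) -> poset le -> poset leU.
Proof.
move=> [g fK gK] fE [r an t]; split.
- by move=> x; rewrite -[x]gK -fE r.
- by move=> x y; rewrite -[x]gK -[y]gK -!fE => /an ->.
- by move=> y x z; rewrite -[x]gK -[y]gK -[z]gK -!fE; apply: t.
Qed.

Lemma Jconn_iso (T U : finType) (le : rel T) (leU : rel U) (f : T -> U) :
  poset le -> bijective f -> (forall x y, le x y = leU (f x) (f y)) ->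
  Jconn leU = [set f @: J | J : {set T} in Jconn le].
Proof.
move=> po f_bij fE; have [g fK gK] := f_bij.
have fimE (J : {set T}) : conn_ideal leU (f @: J) = conn_ideal le J.
  apply: conn_ideal_imset => //; first exact: poset_iso fE po.
  - exact: can_inj fK.
  - by move=> u x _; exists (g u).
apply/setP=> K; rewrite in_Jconn; apply/idP/imsetP=> [K_conn|[J + ->]]; last first.
  by rewrite in_Jconn fimE.
have KE : K = f @: (f @^-1: K).
  apply/setP=> u; apply/idP/imsetP=> [uK|[x + ->]]; last by rewrite inE.
  by exists (g u); rewrite ?inE gK.
by exists (f @^-1: K); rewrite // in_Jconn -fimE -KE.
Qed.

Lemma forest_dup_poset (T : finType) (le : rel T) : forest_dup le -> poset le.
Proof.
elim=> {T le}.
- by split=> // -[] [].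
- by move=> *; apply: dunion_poset.
- by move=> *; apply: hang_poset.
- by move=> *; apply: dup_poset.
- by move=> T U le leU f _ po f_bij fE; apply: (poset_iso f_bij fE po).
Qed.

Lemma Jconn_unit : Jconn (fun _ _ : unit => true) = [set setT].
Proof.
apply/setP=> J; rewrite in_set1 in_Jconn; apply/idP/eqP=> [|->].
  by case/and3P=> /set0Pn[[] xJ] _ _; apply/setP=> -[]; rewrite xJ inE.
have po : poset (fun _ _ : unit => true) by split=> // -[] [].
have := conn_ideal_principal tt po.
by congr (is_true (conn_ideal _ _)); apply/setP=> -[]; rewrite !inE.
Qed.

Lemma crossing1 (T : finType) (J : {set T}) : crossing [set J] = set0.
Proof.
apply/setP=> S; rewrite in_set0; apply/crossingP=> -[K [L []]].
by rewrite !in_set1 => /eqP-> /eqP-> /intersect_nontriv_neq /eqP.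
Qed.

(** All three counts add up under disjoint union and hanging. A duplication adds one element, the
    two ideals [Qa] and [Qa'], and the single crossing pair they form. *)
Lemma card_Jconn (T : finType) (le : rel T) : forest_dup le ->
  #|Jconn le| = (#|T| + #|crossing (Jconn le)|)%N.
Proof.
elim=> {T le}.
- by rewrite Jconn_unit crossing1 cards1 cards0 card_unit.
- move=> T1 T2 le1 le2 /forest_dup_poset po1 IH1 /forest_dup_poset po2 IH2.
  have D := Jconn_dunion_disjoint le2 po1; have C := @Jconn_dunion_noncrossing _ _ le1 le2.
  have il : injective (@inl T1 T2) by move=> ? ? [].
  have ir : injective (@inr T1 T2) by move=> ? ? [].
  rewrite Jconn_dunion // card_disjointU // card_crossingU //.
  rewrite !card_imset ?IH1 ?IH2; try exact: imset_inj.
  rewrite (card_crossing_imset (imset_inj il)); last first.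
    by move=> *; rewrite intersect_nontriv_imset.
  rewrite (card_crossing_imset (imset_inj ir)); last first.
    by move=> *; rewrite intersect_nontriv_imset.
  by rewrite card_sum; lia.
- move=> T1 T2 le1 le2 a /forest_dup_poset po1 IH1 /forest_dup_poset po2 IH2.
  have D := Jconn_hang_disjoint le2 a po1; have C := @Jconn_hang_noncrossing _ _ le1 le2 a.
  have ir : injective (@inr T1 T2) by move=> ? ? [].
  have ip := preimset_can_inj (@inl_hangK T1 T2 a).
  rewrite Jconn_hang // card_disjointU // card_crossingU //.
  rewrite !card_imset ?IH1 ?IH2 //; try exact: imset_inj.
  rewrite (card_crossing_imset ip); last first.
    by move=> *; rewrite (intersect_nontriv_preimset _ _ (@inl_hangK T1 T2 a)).
  rewrite (card_crossing_imset (imset_inj ir)); last first.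
    by move=> *; rewrite intersect_nontriv_imset.
  by rewrite card_sum; lia.
- move=> T le a /forest_dup_poset po IH ha.
  have D := Jconn_dup_disjoint a po; have C := Jconn_dup_noncrossing po ha.
  have ip := preimset_can_inj (@Some_dupK T a).
  have X := intersect_nontriv_dup po ha.
  rewrite Jconn_dup // card_disjointU // card_crossingU // crossing2 //.
  rewrite card_imset // cards2 (intersect_nontriv_neq X) cards1.
  rewrite (card_crossing_imset ip).
    by rewrite IH card_option; lia.
  by move=> *; rewrite (intersect_nontriv_preimset _ _ (@Some_dupK T a)).
- move=> T U le leU f /forest_dup_poset po IH f_bij fE.
  have f_inj := bij_inj f_bij.
  rewrite (Jconn_iso po f_bij fE) (card_crossing_imset (imset_inj f_inj)).
    by rewrite card_imset ?IH ?(bij_eq_card f_bij) //; apply: imset_inj.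
  by move=> *; rewrite intersect_nontriv_imset.
Qed.

(** * The product formula for P-partitions *)

Definition ppart (T : finType) (le : rel T) (f : {ffun T -> nat}) : bool :=
  [forall x, forall y, le x y ==> (f y <= f x)%N].

Lemma ppartP (T : finType) (le : rel T) (f : {ffun T -> nat}) :
  reflect (forall x y, le x y -> (f y <= f x)%N) (ppart le f).
Proof.
apply: (iffP forallP) => [H x y xy|H x]; last first.
  by apply/forallP=> y; apply/implyP; apply: H.
by have /forallP/(_ y)/implyP := H x; apply.
Qed.

(** Arbitrary positive weights are needed for the induction, since hanging and duplication invoke
    the formula for pushed-forward weights. The denominator is multiplied out to stay within
    polynomials. *)
Definition gf_formula (T : finType) (le : rel T) : Prop :=
  forall (N : nat) (c : T -> nat), (forall x, 0 < c x)%N ->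
    exists2 p, is_gf N (ppart le) (fwt c) p
             & eqX N (p * ideal_den c (Jconn le)) (ideal_num c (Jconn le)).

Lemma gf_formula_unit : gf_formula (fun _ _ : unit => true).
Proof.
move=> N c c_gt0; exists (\prod_(x : unit) \sum_(k < N) 'X^(c x * k)).
  apply: (@is_gf_bij _ _ _ predT _ (fwt c) _ id) (is_gf_ffun N c_gt0) => //.
  - by move=> f _; apply/ppartP=> -[] [].
  - by move=> f; exists f.
rewrite /ideal_num Jconn_unit crossing1 big_set0.
rewrite /ideal_den big_set1 /cwt.
rewrite (big_pred1 tt) => [|[]//]; rewrite (big_pred1 tt) => [|[]]; last by rewrite inE.
exact: geometric_sum.
Qed.

Lemma gf_formula_dunion (T1 T2 : finType) (le1 : rel T1) (le2 : rel T2) :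
  poset le1 -> poset le2 -> gf_formula le1 -> gf_formula le2 ->
  gf_formula (dunion_rel le1 le2).
Proof.
move=> po1 po2 gf1 gf2 N c c_gt0.
have [p1 gp1 E1] := gf1 N (c \o inl) (fun x => c_gt0 _).
have [p2 gp2 E2] := gf2 N (c \o inr) (fun x => c_gt0 _).
have D := Jconn_dunion_disjoint le2 po1; have C := @Jconn_dunion_noncrossing _ _ le1 le2.
have il : injective (@inl T1 T2) by move=> ? ? [].
have ir : injective (@inr T1 T2) by move=> ? ? [].
exists (p1 * p2).
  pose h (z : {ffun T1 -> nat} * {ffun T2 -> nat}) : {ffun T1 + T2 -> nat} :=
    [ffun u => match u with inl x => z.1 x | inr y => z.2 y end].
  apply: (is_gf_bij (h := h)) (is_gf_prod gp1 gp2).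
  - move=> [f1 f2] /= /andP[/ppartP P1 /ppartP P2]; apply/ppartP.
    by move=> [x|x] [y|y] //=; rewrite !ffunE; [apply: P1 | apply: P2].
  - move=> [f1 f2] _; rewrite /fwt big_sumType /=.
    by congr (_ + _)%N; apply: eq_bigr => x _; rewrite ffunE.
  - move=> [f1 f2] [g1 g2] _ _ /ffunP E; congr (_, _); apply/ffunP=> x.
      by have := E (inl x); rewrite !ffunE.
    by have := E (inr x); rewrite !ffunE.
  - move=> f /ppartP P; exists ([ffun x => f (inl x)], [ffun x => f (inr x)]).
      by apply/andP; split; apply/ppartP=> x y xy; rewrite !ffunE; apply: P.
    by apply/ffunP=> -[x|x]; rewrite !ffunE.
rewrite Jconn_dunion // ideal_denU // ideal_numU //.
rewrite (@ideal_den_imset _ _ _ (imset_inj il) (c \o inl)); last by move=> *; rewrite cwt_imset.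
rewrite (@ideal_den_imset _ _ _ (imset_inj ir) (c \o inr)); last by move=> *; rewrite cwt_imset.
rewrite (@ideal_num_imset _ _ _ (imset_inj il) _ (c \o inl)); first last.
- by move=> *; rewrite cwt_imset.
- by move=> *; rewrite intersect_nontriv_imset.
rewrite (@ideal_num_imset _ _ _ (imset_inj ir) _ (c \o inr)); first last.
- by move=> *; rewrite cwt_imset.
- by move=> *; rewrite intersect_nontriv_imset.
by rewrite mulrACA; apply: eqX_mul.
Qed.

Lemma gf_formula_hang (T1 T2 : finType) (le1 : rel T1) (le2 : rel T2) a :
  poset le1 -> poset le2 -> gf_formula le1 -> gf_formula le2 ->
  gf_formula (hang_rel le1 le2 a).
Proof.
move=> po1 po2 gf1 gf2 N c c_gt0; have [r1 _ _] := po1.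
have sK := @inl_hangK T1 T2 a.
have [p1 gp1 E1] := gf1 N (pushforward (hang_proj a) c)
  (fun x => pushforward_gt0 x sK c_gt0).
have [p2 gp2 E2] := gf2 N (c \o inr) (fun x => c_gt0 _).
have D := Jconn_hang_disjoint le2 a po1; have C := @Jconn_hang_noncrossing _ _ le1 le2 a.
have ir : injective (@inr T1 T2) by move=> ? ? [].
exists (p1 * p2).
  pose h (z : {ffun T1 -> nat} * {ffun T2 -> nat}) : {ffun T1 + T2 -> nat} :=
    [ffun u => match u with inl x => z.1 x | inr y => (z.1 a + z.2 y)%N end].
  apply: (is_gf_bij (h := h)) (is_gf_prod gp1 gp2).
  - move=> [f1 f2] /= /andP[/ppartP P1 /ppartP P2]; apply/ppartP.
    move=> [x|x] [y|y] //=; rewrite !ffunE /= => xy; first exact: P1.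
      by apply: leq_trans (leq_addr _ _); apply: P1.
    by rewrite leq_add2l P2.
  - move=> [f1 f2] _; rewrite fwt_pushforward /fwt !big_sumType /= -addnA -big_split /=.
    congr (_ + _)%N; apply: eq_bigr => x _; rewrite ffunE //=.
    by rewrite mulnDr.
  - move=> [f1 f2] [g1 g2] _ _ /ffunP E.
    have fg1 : f1 = g1 by apply/ffunP=> x; have := E (inl x); rewrite !ffunE.
    congr (_, _) => //; apply/ffunP=> x.
    by have := E (inr x); rewrite !ffunE /= fg1 => /addnI.
  - move=> f /ppartP P.
    (* The truncated subtraction is exact: elements of [T2] lie below [a], so [f] is at least
       [f (inl a)] on them. *)
    exists ([ffun x => f (inl x)], [ffun x => (f (inr x) - f (inl a))%N]).
      apply/andP; split; apply/ppartP=> x y xy; rewrite !ffunE; first exact: P.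
      exact/leq_sub2r/P.
    apply/ffunP=> -[x|x]; rewrite !ffunE /= ?ffunE // subnKC //.
    by apply: P => /=.
rewrite Jconn_hang // ideal_denU // ideal_numU //.
rewrite (@ideal_den_imset _ _ _ (preimset_can_inj sK) (pushforward (hang_proj a) c)); last first.
  by move=> J; rewrite cwt_preimset.
rewrite (@ideal_den_imset _ _ _ (imset_inj ir) (c \o inr)); last by move=> *; rewrite cwt_imset.
rewrite (@ideal_num_imset _ _ _ (preimset_can_inj sK) _ (pushforward (hang_proj a) c)); first last.
- by move=> *; rewrite cwt_preimset.
- by move=> *; rewrite (intersect_nontriv_preimset _ _ sK).
rewrite (@ideal_num_imset _ _ _ (imset_inj ir) _ (c \o inr)); first last.
- by move=> *; rewrite cwt_imset.
- by move=> *; rewrite intersect_nontriv_imset.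
by rewrite mulrACA; apply: eqX_mul.
Qed.

Lemma gf_formula_iso (T U : finType) (le : rel T) (leU : rel U) (f : T -> U) :
  poset le -> bijective f -> (forall x y, le x y = leU (f x) (f y)) ->
  gf_formula le -> gf_formula leU.
Proof.
move=> po f_bij fE gf N c c_gt0; have f_inj := bij_inj f_bij.
have [p gp E] := gf N (c \o f) (fun x => c_gt0 _); exists p.
  have [g fK gK] := f_bij.
  pose h (F : {ffun T -> nat}) : {ffun U -> nat} := [ffun u => F (g u)].
  apply: (is_gf_bij (h := h)) gp.
  - move=> F /ppartP P; apply/ppartP=> x y; rewrite -[x]gK -[y]gK -fE !ffunE !fK.
    exact: P.
  - move=> F _; rewrite /fwt (reindex f) /=; last exact: onW_bij.
    by apply: eq_bigr => x _; rewrite ffunE fK.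
  - by move=> F G _ _ /ffunP FG; apply/ffunP=> x; have := FG (f x); rewrite !ffunE fK.
  - move=> F /ppartP P; exists [ffun x => F (f x)].
      by apply/ppartP=> x y; rewrite fE !ffunE; apply: P.
    by apply/ffunP=> u; rewrite !ffunE gK.
rewrite (Jconn_iso po f_bij fE).
rewrite (@ideal_den_imset _ _ _ (imset_inj f_inj) (c \o f)); last by move=> *; rewrite cwt_imset.
rewrite (@ideal_num_imset _ _ _ (imset_inj f_inj) _ (c \o f)) //.
- by move=> *; rewrite intersect_nontriv_imset.
- by move=> *; rewrite cwt_imset.
Qed.

(* [t] and [t'] are the two copies of [a]; the offset [e] is 0 or 1, so that the ties
   [F t = F t'] are counted in only one of the two halves. *)
Lemma is_gf_dup_half N (T : finType) (le : rel T) a (c : option T -> nat)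
    (t t' : option T) e p :
  poset le -> hanger le a -> (forall u, 0 < c u)%N ->
  dup_proj a t = a -> dup_proj a t' = a -> t != t' ->
  is_gf N (ppart le) (fwt (pushforward (dup_proj a) c)) p ->
  is_gf N (fun F : {ffun option T -> nat} => ppart (dup_rel le a) F && (F t' + e <= F t)%N) (fwt c)
    (p * (\sum_(k < N) 'X^(cwt c [set u | dup_rel le a u t] * k))
       * 'X^(cwt c [set u | dup_rel le a u t] * e)).
Proof.
move=> po ha c_gt0 ta t'a tt' gp.
have [r an tr] := po; have [r' an' tr'] := dup_poset a po.
have tE : t = Some a /\ t' = None \/ t = None /\ t' = Some a.
  case: t t' ta t'a tt' => [x|] [y|] /= xa ya; rewrite ?xa ?ya ?eqxx // => _.
    by left.
  by right.
have nt't : dup_rel le a t' t = false.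
  by case: tE => -[-> ->] //=; rewrite /plt eqxx andbF.
(* By the hanger condition, stepping up out of the principal ideal of [t] lands above [a], hence
   above [t']. *)
have cross_up x y : le x y -> dup_rel le a (Some x) t ->
    ~~ dup_rel le a (Some y) t -> dup_rel le a t' (Some y).
  move=> xy; case: tE => -[-> ->] /= xa nya; last by rewrite -(ha.2 x y).
  have [xa'|nxa] := eqVneq x a.
    by rewrite /plt -xa' xy; apply: contraNneq nya => <-; rewrite xa' r.
  rewrite /plt -(ha.2 x y) ?xy ?/plt ?xa ?nxa //=; last by rewrite (negPf nya).
  by apply: contraNneq nya => <-.
have d_gt0 : (0 < cwt c [set u | dup_rel le a u t])%N.
  by rewrite /cwt (bigD1 t) ?inE //= addn_gt0 c_gt0.
set d := cwt c _ in d_gt0 *.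
(* Both copies start from the value [f a]; raising the principal ideal of [t] by [k + e] makes the
   difference between [F t] and [F t'] equal to [k + e], at a cost of [d * (k + e)] in weight. *)
pose h (z : {ffun T -> nat} * nat) : {ffun option T -> nat} :=
  [ffun u => (z.1 (dup_proj a u) + (if dup_rel le a u t then z.2 + e else 0))%N].
have hM u v : dup_rel le a u v -> le (dup_proj a u) (dup_proj a v).
  by case: u v => [x|] [y|] //= /pltW.
apply: (is_gf_bij (h := h)) (is_gf_shift (d * e) (is_gf_prod gp (is_gf_nat N d_gt0))).
- move=> [f k] /= /andP[/ppartP P _]; apply/andP; split; last first.
    by rewrite !ffunE ta t'a nt't r' addn0 leq_add2l leq_addl.
  apply/ppartP=> u v uv; rewrite !ffunE /=; apply: leq_add; first exact/P/hM.
  by case vt: (dup_rel le a v t) => //; rewrite (tr' _ _ _ uv vt).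
- move=> [f k] _; rewrite fwt_pushforward /fwt /=.
  under eq_bigr => u _ do rewrite ffunE mulnDr /=.
  rewrite big_split /= -addnA; congr (_ + _)%N.
  rewrite -mulnDr /d /cwt big_distrl /= [RHS]big_mkcond; apply: eq_bigr => u _.
  by rewrite inE; case: ifP; rewrite ?muln0.
- move=> [f k] [g l] _ _ /ffunP E.
  have fga : f a = g a by have := E t'; rewrite !ffunE t'a nt't !addn0.
  have kl : k = l by have := E t; rewrite !ffunE ta r' /= fga => /addnI/addIn.
  congr (_, _) => //; apply/ffunP=> x; have := E (Some x); rewrite !ffunE /= kl.
  exact: addIn.
- move=> F /andP[/ppartP P le_t].
  (* The inverse lowers [F] on the principal ideal of [t] until both copies of [a] have the value
     [F t']. *)
  pose G u := (F u - (if dup_rel le a u t then F t - F t' else 0))%N.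
  have le_G u : ((if dup_rel le a u t then F t - F t' else 0) <= F u)%N.
    by case: ifP => // /P; apply: leq_trans; apply: leq_subr.
  have Ga u : dup_proj a u = a -> G u = F t'.
    have Gt : G t = F t' by rewrite /G r' subKn // (leq_trans _ le_t) // leq_addr.
    have Gt' : G t' = F t' by rewrite /G nt't subn0.
    suff: dup_proj a u = a -> u = t \/ u = t' by move=> H /H[] ->.
    by case: u tE => [x|] [] [-> ->] /=; [move=> ->; left | move=> ->; right | right | left].
  exists ([ffun x => G (Some x)], (F t - F t' - e)%N).
    rewrite andbT; apply/ppartP=> x y xy; rewrite !ffunE /G.
    have Pxy : (F (Some y) <= F (Some x))%N by apply: P.
    case xt: (dup_rel le a (Some x) t); case yt: (dup_rel le a (Some y) t).
    + exact: leq_sub2r.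
    (* Only [x] is lowered here. Since [y] is above [t'], [F (Some y)] is at most [F t'], while
       [F (Some x)] is at least [F t] and so stays at least [F t'] after lowering. *)
    + have /P Py : dup_rel le a t' (Some y) by apply: cross_up xy xt _; rewrite yt.
      move: (P _ _ xt) le_t Py.
      by move: (F t) (F t') (F (Some x)) (F (Some y)) => m n k l; lia.
    + have xy' : dup_rel le a (Some x) (Some y) by [].
      by rewrite (tr' _ _ _ xy' yt) in xt.
    + exact: leq_sub2r.
  apply/ffunP=> u; rewrite !ffunE /=.
  have -> : G (Some (dup_proj a u)) = G u.
    by case: u => [//|]; rewrite !Ga.
  move: (le_G u) le_t; rewrite /G.
  by move: (F t) (F t') (F u) => m n k; case: ifP => _; lia.
Qed.

Lemma gf_formula_dup (T : finType) (le : rel T) a :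
  poset le -> hanger le a -> gf_formula le -> gf_formula (dup_rel le a).
Proof.
move=> po ha gf N c c_gt0; have [r an tr] := po; have [r' _ _] := dup_poset a po.
have sK := @Some_dupK T a.
have [p gp E] := gf N (pushforward (dup_proj a) c) (fun x => pushforward_gt0 x sK c_gt0).
(* The two halves are [F None <= F (Some a)] and [F (Some a) < F None]; the offset 1 makes the
   second inequality strict. *)
have g1 := @is_gf_dup_half N T le a c (Some a) None 0 p po ha c_gt0 erefl erefl isT gp.
have g2 := @is_gf_dup_half N T le a c None (Some a) 1 p po ha c_gt0 erefl erefl isT gp.
have D := Jconn_dup_disjoint a po; have C := Jconn_dup_noncrossing po ha.
have X := intersect_nontriv_dup po ha.
have d_gt0 t : (0 < cwt c [set u | dup_rel le a u t])%N.
  by rewrite /cwt (bigD1 t) ?inE //= addn_gt0 c_gt0.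
have G1 := geometric_sum N (d_gt0 (Some a)).
have G2 := geometric_sum N (d_gt0 None).
set Qa := [set u | dup_rel le a u (Some a)] in D C X g1 G1.
set Qa' := [set u | dup_rel le a u None] in D C X g2 G2.
eexists.
  apply: is_gf_disjointU g1 g2 => F; last first.
    by move=> /andP[_]; rewrite addn0 addn1 ltnNge => ->; rewrite andbF.
  by rewrite addn0 addn1 -andb_orr leqNgt orNb andbT.
rewrite Jconn_dup // ideal_denU // ideal_numU //.
rewrite (@ideal_den_imset _ _ _ (preimset_can_inj sK) (pushforward (dup_proj a) c)); last first.
  by move=> J; rewrite cwt_preimset.
rewrite (@ideal_num_imset _ _ _ (preimset_can_inj sK) _ (pushforward (dup_proj a) c)); first last.
- by move=> *; rewrite cwt_preimset.
- by move=> *; rewrite (intersect_nontriv_preimset _ _ sK).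
have nQ : Qa \notin [set Qa'] by rewrite in_set1 (intersect_nontriv_neq X).
rewrite {2}/ideal_den {2}/ideal_num crossing2 // big_set1 !big_setU1 // !big_set1.
rewrite muln0 expr0 mulr1 muln1 exprD.
move: (ideal_den _ _) (ideal_num _ _) E => den num E.
set u := 'X^(cwt c Qa) in G1 *; set v := 'X^(cwt c Qa') in G2 *.
set s1 := \sum_(k < N) _ in G1 *; set s2 := \sum_(k < N) _ in G2 *.
(* With [s1] and [s2] standing for [1 / (1 - u)] and [1 / (1 - v)], the bracket reduces to
   [(1 - v) + v * (1 - u)], which is [1 - u * v], the factor of the new crossing pair. *)
have -> : (p * s1 + p * s2 * v) * (den * ((1 - u) * (1 - v)))
    = (p * den) * ((s1 * (1 - u)) * (1 - v) + (s2 * (1 - v)) * (v * (1 - u))) by ring.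
have -> : 1 - u * v = 1 * (1 - v) + 1 * (v * (1 - u)) by ring.
apply: eqX_mul => //; apply: eqX_add; apply: eqX_mul => //; exact: eqX_refl.
Qed.

Lemma forest_dup_gf_formula (T : finType) (le : rel T) :
  forest_dup le -> gf_formula le.
Proof.
elim=> {T le}.
- exact: gf_formula_unit.
- by move=> T1 T2 le1 le2 /forest_dup_poset po1 ? /forest_dup_poset po2 ?; apply: gf_formula_dunion.
- by move=> T1 T2 le1 le2 a /forest_dup_poset po1 ? /forest_dup_poset po2 ?; apply: gf_formula_hang.
- by move=> T le a /forest_dup_poset po ? ?; apply: gf_formula_dup.
- move=> T U le leU f /forest_dup_poset po ? f_bij fE; exact: (gf_formula_iso po f_bij fE).
Qed.

(** * P-partitions and linear extensions *)

Lemma card_ord_lt n m : (m <= n)%N -> #|[pred i : 'I_n | (i < m)%N]| = m.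
Proof.
move=> le_mn; rewrite -sum1_card.
by rewrite (big_ord_narrow (F := fun=> 1%N) le_mn) sum_nat_const card_ord muln1.
Qed.

Section LinearExtensions.
Variable n : nat.
Implicit Types (w : 'S_n) (f k : {ffun 'I_n -> nat}).

Definition letter w (m : nat) : nat := nth 0%N [seq val (w i) | i <- enum 'I_n] m.

Lemma letterE w (i : 'I_n) : letter w i = w i.
Proof. by rewrite /letter (nth_map i) ?size_enum_ord // nth_ord_enum. Qed.

(** The guard excludes the last position, where the next letter would be the default 0 and could
    pass for a descent. *)
Definition desc w (m : nat) : bool := (m.+1 < n)%N && (letter w m.+1 < letter w m)%N.

Lemma majE w : maj w = (\sum_(j < n) desc w j * j.+1)%N.
Proof.
rewrite /maj big_mkcond /=.
have -> : (\sum_(j < n) desc w j * j.+1 =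
    \sum_(0 <= j < n.-1) desc w j * j.+1)%N.
  rewrite -(big_mkord xpredT (fun j => desc w j * j.+1)%N).
  rewrite (@big_cat_nat _ _ _ n.-1) //= ?leq_pred // [X in (_ + X)%N]big_nat.
  by rewrite [X in (_ + X)%N]big1 ?addn0 // => j jn; rewrite /desc; case: ltnP => //; lia.
apply: eq_big_nat => j /andP[_ jn]; rewrite /desc -/(letter w j) -/(letter w j.+1).
have -> : (j.+1 < n)%N by lia.
by case: ifP => _; rewrite ?mul1n.
Qed.

(* [y] is read before [x] when the letters are sorted by decreasing value of [f],
   ties being broken by increasing label. *)
Definition before f (y x : 'I_n) : bool :=
  (f x < f y)%N || (f x == f y) && (y < x)%N.

Lemma before_trans f : transitive (before f).
Proof. by move=> y x z; rewrite /before; lia. Qed.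

Lemma before_irr f x : before f x x = false.
Proof. by rewrite /before; lia. Qed.

Lemma before_total f x y : x != y -> ~~ before f x y -> before f y x.
Proof. by rewrite /before -val_eqE /=; lia. Qed.

Definition sorts f w : Prop := forall i j : 'I_n, (i < j)%N -> before f (w i) (w j).

(** The position of [x] in the sorted word. It determines the sorting permutation, and its inverse
    provides one. *)
Definition rank f (x : 'I_n) : nat := #|[set y | before f y x]|.

Lemma rank_sorts f w i : sorts f w -> rank f (w i) = i.
Proof.
move=> fw; rewrite /rank.
have -> : [set y | before f y (w i)] = w @: [set j : 'I_n | (j < i)%N].
  apply/setP=> y; rewrite -[y](permKV w) mem_imset; last exact: perm_inj.
  rewrite !inE; move: (w^-1%g y) => j; apply/idP/idP; last exact: fw.
  apply: contraTT; rewrite -leqNgt leq_eqVlt => /orP[/eqP/val_inj->|/fw ij].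
    by rewrite before_irr.
  by apply/negP=> /(before_trans ij); rewrite before_irr.
rewrite card_imset; last exact: perm_inj.
by rewrite cardsE card_ord_lt // ltnW.
Qed.

Lemma sorts_unique f w w' : sorts f w -> sorts f w' -> w = w'.
Proof.
move=> fw fw'; apply/permP=> i; rewrite -[RHS](permKV w); congr (w _).
apply: val_inj; rewrite /= -(rank_sorts i fw').
by rewrite -[w' i in LHS](permKV w) (rank_sorts _ fw).
Qed.

Lemma sorts_exists f : exists w, sorts f w.
Proof.
have rank_lt x : (rank f x < n)%N.
  rewrite -[X in (_ < X)%N]card_ord -cardsT; apply: proper_card.
  by apply/properP; split; [apply: subsetT | exists x; rewrite !inE ?before_irr].
have rankM x y : before f x y -> (rank f x < rank f y)%N.
  move=> xy; apply/proper_card/properP; split.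
    by apply/subsetP=> z; rewrite !inE => /before_trans; apply.
  by exists x; rewrite !inE ?before_irr.
have rank_inj : injective (fun x => Ordinal (rank_lt x)).
  move=> x y /(congr1 val) /= xy; apply/eqP; apply: contraT => nxy.
  have [/rankM|/(before_total nxy)/rankM] := boolP (before f x y); by rewrite xy ltnn.
pose w : 'S_n := (perm rank_inj)^-1%g.
have rk l : rank f (w l) = l.
  by have /(congr1 val) := permKV (perm rank_inj) l; rewrite permE.
exists w => i j; apply: contraTT; rewrite -leqNgt -(rk i) -(rk j).
move: (w i) (w j) => x y nxy.
have [-> //|nexy] := eqVneq x y.
exact/ltnW/rankM/before_total.
Qed.

(** The value to be put on the letter at position [m]. From position [j] to the next the value drops
    by [k j], plus one unit forced at a descent, and past the end it is 0. *)
Definition height w k (m : nat) : nat :=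
  (\sum_(j < n | (m <= j)%N) (k j + desc w j))%N.

Lemma heightS w k (i : 'I_n) : height w k i = (k i + desc w i + height w k i.+1)%N.
Proof.
rewrite /height (bigD1 i) //=; congr (_ + _)%N; apply: eq_bigl => j.
by rewrite andbC -val_eqE /=; lia.
Qed.

Lemma height_n w k : height w k n = 0%N.
Proof. by rewrite /height big_pred0 // => j; rewrite leqNgt ltn_ord. Qed.

Definition unsort (z : 'S_n * {ffun 'I_n -> nat}) : {ffun 'I_n -> nat} :=
  [ffun x => height z.1 z.2 (z.1^-1%g x)].

Lemma unsortE w k (i : 'I_n) : unsort (w, k) (w i) = height w k i.
Proof. by rewrite ffunE /= permK. Qed.

(** By transitivity adjacent positions suffice: at a descent the forced unit makes the drop strict,
    and at an ascent a tie is broken in favour of the smaller label. *)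
Lemma unsort_sorts w k : sorts (unsort (w, k)) w.
Proof.
move=> i j; have [m] := ubnP (j - i)%N; elim: m i => // m IHm i le_m ij.
have i1n : (i.+1 < n)%N by apply: leq_ltn_trans ij (ltn_ord j).
have step : before (unsort (w, k)) (w i) (w (Ordinal i1n)).
  rewrite /before !unsortE (heightS _ _ i) /= /desc i1n /=.
  rewrite -[X in letter w X]/(val (Ordinal i1n)) !letterE.
  have : w i != w (Ordinal i1n) by rewrite (inj_eq perm_inj) -val_eqE /=; lia.
  by rewrite -val_eqE /=; case: ltnP; lia.
have [eqj|nj] := eqVneq (i.+1) j.
  by have -> : j = Ordinal i1n by apply: val_inj.
by apply: before_trans step (IHm (Ordinal i1n) _ _) => /=; lia.
Qed.

Lemma fwt_unsort w k :
  fwt (fun=> 1%N) (unsort (w, k)) = (maj w + fwt (fun i : 'I_n => i.+1) k)%N.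
Proof.
rewrite /fwt (reindex_inj (@perm_inj _ w)) /=.
under eq_bigr => i _ do rewrite mul1n unsortE /height.
(* The drop at [j] counts once for each of the positions [0..j], that is [j.+1] times; the forced
   units thus add up to [maj w]. *)
rewrite (exchange_big_dep predT) //= majE -big_split /=.
apply: eq_bigr => j _; rewrite sum_nat_const (card_ord_lt (ltn_ord j)); lia.
Qed.

(** The permutation is recovered as the only one sorting the result, and [k] from consecutive
    differences of heights. *)
Lemma unsort_inj : injective unsort.
Proof.
move=> [w k] [w' k'] E.
have ww' : w = w'.
  by apply: sorts_unique (unsort_sorts w k) _; rewrite E; apply: unsort_sorts.
rewrite -{w'}ww' in E *; congr (_, _); apply/ffunP=> i.
have hE (m : nat) : (m <= n)%N -> height w k m = height w k' m.
  rewrite leq_eqVlt => /orP[/eqP->|mn]; first by rewrite !height_n.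
  by rewrite -(unsortE w k (Ordinal mn)) E unsortE.
have := hE i (ltnW (ltn_ord i)); rewrite !heightS (hE i.+1) //.
by move=> /addIn/addIn.
Qed.

Lemma unsort_surj f w : sorts f w -> exists k, unsort (w, k) = f.
Proof.
move=> fw.
(* The values of [f] along the word, extended by 0 so that the last drop is the last value. *)
pose F m := (if insub m is Some i then f (w i) else 0)%N.
have FE (i : 'I_n) : F i = f (w i) by rewrite /F valK.
have Fn : F n = 0%N by rewrite /F insubF // ltnn.
(* At a descent the labels decrease, so sortedness excludes a tie and the drop is at least one. *)
have FS (i : 'I_n) : (F i.+1 + desc w i <= F i)%N.
  have [i1n|] := ltnP i.+1 n; last first.
    move=> ni; have -> : i.+1 = n by apply/eqP; rewrite eqn_leq ni ltn_ord.
    by rewrite Fn /desc; have := ltn_ord i; lia.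
  have := fw i (Ordinal i1n) (ltnSn _).
  rewrite /before -!FE /= /desc i1n /=.
  by rewrite -[X in (letter w X < _)%N]/(val (Ordinal i1n)) !letterE; lia.
exists [ffun i : 'I_n => (F i - F i.+1 - desc w i)%N].
(* Heights are sums of tails, hence the induction from the end of the word. *)
have hE m : (m <= n)%N -> height w [ffun i : 'I_n => (F i - F i.+1 - desc w i)%N] (n - m) = F (n - m)%N.
  elim: m => [|m IHm] mn; first by rewrite subn0 height_n Fn.
  have lt_n : (n - m.+1 < n)%N by lia.
  rewrite (heightS _ _ (Ordinal lt_n)) /= ffunE /= -subSn // subSS (IHm (ltnW mn)).
  have := FS (Ordinal lt_n); rewrite /= -subSn // subSS; lia.
apply/ffunP=> x; rewrite -[x](permKV w) unsortE.
move: (w^-1%g x) => i; have := hE (n - i)%N (leq_subr _ _).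
by rewrite subKn ?FE // ltnW.
Qed.

Variable le : rel 'I_n.
Hypothesis le_nat : naturally_labelled le.

(** An order relation from [w i] to [w j] makes [f] weakly decrease, and the natural labelling makes
    the tie-break agree with it, so [w i] is read first. Conversely [f] weakly decreases along the
    sorted word. *)
Lemma linext_ppart f w : sorts f w -> (w \in linext le) = ppart le f.
Proof.
move=> fw; rewrite inE; apply/forallP/ppartP=> [wP x y xy|P i].
  have [->//|nxy] := eqVneq x y.
  have := wP (w^-1%g x) => /forallP/(_ (w^-1%g y)); rewrite !permKV /plt xy nxy /=.
  by move=> /fw; rewrite !permKV /before; lia.
apply/forallP=> j; apply/implyP=> ij; rewrite ltnNge; apply/negP.
have wij : before f (w i) (w j).
  by rewrite /before (le_nat ij) andbT orbC -leq_eqVlt (P _ _ (pltW ij)).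
rewrite leq_eqVlt => /orP[/eqP/val_inj E|/fw ji].
  by move: wij; rewrite E before_irr.
by have := before_trans wij ji; rewrite before_irr.
Qed.

(** Stanley's theorem on P-partitions: via [unsort], the vectors [k] contribute the inverse of
    [(1 - 'X) ... (1 - 'X^n)], here truncated. *)
Lemma is_gf_ppart_linext N :
  is_gf N (ppart le) (fwt (fun=> 1%N))
    ((\sum_(w in linext le) 'X^(maj w)) *
     \prod_(i < n) \sum_(k < N) 'X^(i.+1 * k)).
Proof.
apply: (is_gf_bij (h := unsort))
  (is_gf_prod (is_gf_fin N (linext le) (@maj n))
              (@is_gf_ffun N _ (fun i : 'I_n => i.+1) (fun=> ltn0Sn _))).
- by move=> [w k] /andP[/= wL _]; rewrite -(linext_ppart (unsort_sorts w k)).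
- by move=> [w k] _; rewrite fwt_unsort.
- by move=> z z' _ _; apply: unsort_inj.
- move=> f fP; have [w fw] := sorts_exists f; have [k kE] := unsort_surj fw.
  by exists (w, k) => //; rewrite /= (linext_ppart fw) fP.
Qed.

End LinearExtensions.

(** * Passage to q-integers *)

Lemma qintE m : 1 - 'X^m = (1 - 'X) * qint m.
Proof. by rewrite -opprB subrX1 -mulNr opprB. Qed.

Lemma qint_horner1 m : (qint m).[1] = m%:R.
Proof.
rewrite /qint horner_sum; under eq_bigr => i _ do rewrite hornerXn expr1n.
by rewrite sumr_const card_ord.
Qed.

Lemma prod_qint_horner1 (I : finType) (D : pred I) (F : I -> nat) :
  (\prod_(i | D i) qint (F i)).[1] = (\prod_(i | D i) F i)%:R.
Proof.
by rewrite horner_prod natr_prod; apply: eq_bigr => i _; rewrite qint_horner1.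
Qed.

Lemma maj_gf_product (n : nat) (le : rel 'I_n) :
  forest_dup le -> naturally_labelled le ->
  (\sum_(w in linext le) 'X^(maj w)) * \prod_(J in Jconn le) qint #|J|
    = qfact n * \prod_(S in Pi le) qint (\sum_(J in S) #|J|)%N.
Proof.
move=> fd nat_le.
have cwt1 (J : {set 'I_n}) : cwt (fun=> 1%N) J = #|J| by rewrite /cwt sum1_card.
pose E : {poly int} := \prod_(i < n) (1 - 'X^(i.+1)).
set W := \sum_(w in _) _.
(* The identity before powers of [1 - 'X] are cancelled: [W / E] and the product formula both
   compute the generating function of P-partitions for unit weights. *)
have WE : W * ideal_den (fun=> 1%N) (Jconn le) = E * ideal_num (fun=> 1%N) (Jconn le).
  apply: eqX_eq => N.
  have [p gp pE] := forest_dup_gf_formula fd N (fun=> isT : 0 < 1)%N.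
  have pW := is_gf_unique gp (is_gf_ppart_linext nat_le N); rewrite -/W in pW.
  set D := \prod_(i < n) _ in pW.
  have DE : eqX N (D * E) 1.
    rewrite /D /E -big_split; apply: (@eqX_trans _ _ (\prod_(i < n) 1)).
      by apply: eqX_prod => i _; apply: geometric_sum.
    by rewrite big1 //; apply: eqX_refl.
  set den := ideal_den _ _ in pE *; set num := ideal_num _ _ in pE *.
  apply: (@eqX_trans _ _ (W * den * (D * E))).
    by rewrite -[X in eqX N X _]mulr1; apply/eqX_mull/eqX_sym.
  have -> : W * den * (D * E) = (W * D) * (den * E) by ring.
  apply: (@eqX_trans _ _ (p * (den * E))).
    by apply: eqX_mul; [apply: eqX_sym | apply: eqX_refl].
  have -> : p * (den * E) = E * (p * den) by ring.
  exact: eqX_mull.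
have nz : ((1 - 'X) ^+ #|Jconn le| : {poly int}) != 0.
  rewrite expf_eq0 negb_and; apply/orP; right.
  by rewrite -opprB oppr_eq0 polyXsubC_eq0.
(* Giving one factor [1 - 'X] to each [qint #|J|] turns the product into [ideal_den]. *)
apply: (mulfI nz); rewrite mulrCA -prodr_const -big_split /=.
under eq_bigr => J _ do rewrite -qintE -cwt1.
(* By [card_Jconn] the power splits into [n] factors, which turn [qfact n] into [E], and one factor
   for each crossing pair. *)
rewrite -/(ideal_den _ _) WE prodr_const card_Jconn // card_ord exprD.
rewrite mulrACA PiE; congr (_ * _).
  rewrite -[X in _ ^+ X]card_ord -prodr_const /qfact -big_split /=.
  by apply: eq_bigr => i _; rewrite qintE.
rewrite -prodr_const -big_split /=; apply: eq_bigr => S _.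
by rewrite -qintE; under eq_bigr => J _ do rewrite cwt1.
Qed.

Unset Implicit Arguments.
Theorem theorem1p1 (n : nat) (le : rel 'I_n) :
  forest_dup le -> naturally_labelled le ->
  ((\sum_(w in linext le) 'X^(maj w)) * \prod_(J in Jconn le) qint #|J|
     = qfact n * \prod_(S in Pi le) qint (\sum_(J in S) #|J|)%N)
  /\
  ((#|linext le| * \prod_(J in Jconn le) #|J|)
     = n`! * \prod_(S in Pi le) (\sum_(J in S) #|J|))%N.
Proof.
move=> fd nat_le; have H := maj_gf_product fd nat_le; split=> //.
(* Evaluating at 1 turns each [qint m] into [m] and each ['X^(maj w)] into 1; the resulting equality
   of integers is one between naturals. *)
have := congr1 (fun p : {poly int} => p.[1]) H; rewrite !hornerM /qfact.
rewrite !prod_qint_horner1 -natrM horner_sum.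
rewrite (eq_bigr (fun=> 1)) => [|w _]; last by rewrite hornerXn expr1n.
rewrite sumr_const -natrM => /eqP; rewrite Num.Theory.eqr_nat => /eqP ->.
by rewrite fact_prod big_add1 big_mkord.
Qed.
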